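(* There is a sequence of real numbers $(\varepsilon_d)_{d\ge 1}$ with $\varepsilon_d \to 0$ as $d\to\infty$ such that for every dimension $d\ge 1$, every bounded, measurable set $S\subset\mathbb{R}^d$ of positive volume, and every $\lambda \ge 3^{-d/2}$, $$\alpha_S(\lambda) \ \ge\ (1+\varepsilon_d)\, \frac{\log(2/\sqrt{3})\cdot d}{2^d},$$ where $\alpha_S(\lambda)$ is the expected packing density of the hard sphere model on $S$ at fugacity $\lambda$.
   Context: $\log$ is the natural logarithm, $d(x,y)$ is Euclidean distance, and $\mathrm{vol}$ is Lebesgue measure on $\mathbb{R}^d$. Let $r_d$ be the radius of a ball of volume $1$ in $\mathbb{R}^d$. For a bounded, measurable set $S\subset\mathbb{R}^d$ and $\lambda>0$, the (grand canonical) hard sphere model on $S$ at fugacity $\lambda$ is the random finite set $\mathbf{X}\subset S$ distributed as a Poisson point process of intensity $\lambda$ on $S$ conditioned on the event that $d(x,y)>2r_d$ for all distinct $x,y\in\mathbf{X}$. Equivalently, put $\hat Z_S(0)=1$ and $$\hat Z_S(k)=\frac{1}{k!}\int_{S^k}\mathbf{1}\{d(x_i,x_j)>2r_d\ \text{for all } i\neq j\}\,dx_1\cdots dx_k \quad (k\ge 1),\qquad Z_S(\lambda)=\sum_{k\ge 0}\lambda^k\hat Z_S(k);$$ then $\mathbb{P}_{S,\lambda}[|\mathbf{X}|=k]=\lambda^k\hat Z_S(k)/Z_S(\lambda)$, and given $|\mathbf X|=k$ the set $\mathbf X$ is uniform over unordered $k$-tuples in $S$ with pairwise distances $>2r_d$.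 Only the centers need lie in $S$. The expected packing density is $\alpha_S(\lambda)=\mathbb{E}_{S,\lambda}|\mathbf{X}|/\mathrm{vol}(S)$. *)

(* Defs.v *)
(* Written with MathComp-Analysis, over an abstract realType. *)
From HB Require Import structures.
From mathcomp Require Import all_boot all_order all_algebra.
From mathcomp Require Import finmap.
From mathcomp Require Import all_classical all_reals all_analysis.
From mathcomp Require Import measurable_realfun lra.

Set Implicit Arguments.
Unset Strict Implicit.
Unset Printing Implicit Defensive.

Import Order.TTheory GRing.Theory Num.Theory.
Import numFieldNormedType.Exports.

Local Open Scope classical_set_scope.
Local Open Scope ring_scope.

Section tuple_measure.
Local Open Scope ereal_scope.
Context d (T : measurableType d) (R : realType).

Definition cons_pair n (p : T * n.-tuple T) : n.+1.-tuple T :=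
  [tuple of p.1 :: p.2].

Lemma measurable_cons_pair n : measurable_fun setT (@cons_pair n).
Proof. exact: measurable_cons. Qed.

Variable mu : {sigma_finite_measure set T -> \bar R}.

Section step.
Variables (n : nat) (nu : {sigma_finite_measure set (n.-tuple T) -> \bar R}).

Definition cons_measure : set (n.+1.-tuple T) -> \bar R :=
  pushforward (mu \x nu) (@cons_pair n).

Let cons_measure0 : cons_measure set0 = 0.
Proof. by rewrite /cons_measure /pushforward preimage_set0 measure0. Qed.

Let cons_measure_ge0 A : 0 <= cons_measure A.
Proof. by rewrite /cons_measure /pushforward measure_ge0. Qed.

Let cons_measure_sigma_additive : semi_sigma_additive cons_measure.
Proof.
pose pm : {measure set _ -> \bar R} :=
  measure_function_pushforward__canonical__measure_function_Measure
    (mu \x nu) (@measurable_cons_pair n).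
exact: (@measure_semi_sigma_additive _ _ _ pm).
Qed.

HB.instance Definition _ := isMeasure.Build _ _ _ cons_measure
  cons_measure0 cons_measure_ge0 cons_measure_sigma_additive.

Let cons_measure_sigma_finite : sigma_finite setT cons_measure.
Proof.
have /sigma_finiteP[F [TF ndF Foo]] := sigma_finiteT mu.
have /sigma_finiteP[G [TG ndG Goo]] := sigma_finiteT nu.
pose g (t : n.+1.-tuple T) : T * n.-tuple T := (thead t, [tuple of behead t]).
have mg : measurable_fun setT g.
  apply/measurable_fun_pairP; split.
    exact: (measurable_tnth ord0).
  exact: measurable_behead.
exists (fun k => g @^-1` (F k `*` G k)) => [|k].
  rewrite -preimage_bigcup (_ : \bigcup_k _ = setT) ?preimage_setT//.
  apply/seteqP; split => // -[x t] _.
  have : [set: T] x by []. rewrite TF => -[i _ Fx].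
  have : [set: n.-tuple T] t by []. rewrite TG => -[j _ Gt].
  exists (maxn i j) => //; split => /=.
    by move: x Fx; exact/subsetPset/ndF/leq_maxl.
  by move: t Gt; exact/subsetPset/ndG/leq_maxr.
have [mF Fk] := Foo k; have [mG Gk] := Goo k; split.
  by rewrite -[X in measurable X]setTI; apply: mg => //; exact: measurableX.
rewrite /cons_measure /pushforward -comp_preimage.
rewrite (_ : _ \o _ = id) ?preimage_id; last first.
  by apply/funext => -[x t]; congr pair; apply/val_inj.
by rewrite product_measure1E// lte_mul_pinfty// ge0_fin_numE.
Qed.

HB.instance Definition _ := Measure_isSigmaFinite.Build _ _ _ cons_measure
  cons_measure_sigma_finite.

End step.

(* The n-fold product of [mu] on n.-tuple T; see [tuple_measure_box]. *)
Fixpoint tuple_measure n : {sigma_finite_measure set (n.-tuple T) -> \bar R} :=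
  match n with
  | 0%N => \d_([tuple] : 0.-tuple T)
  | n'.+1 => cons_measure (tuple_measure n')
  end.

End tuple_measure.
Section tuple_measure_theory.
Local Open Scope ereal_scope.
Context d (T : measurableType d) (R : realType).
Variable mu : {sigma_finite_measure set T -> \bar R}.

Definition box n (A : 'I_n -> set T) : set (n.-tuple T) :=
  [set t | forall i, A i (tnth t i)].

Lemma measurable_box n (A : 'I_n -> set T) :
  (forall i, measurable (A i)) -> measurable (box A).
Proof.
move=> mA.
have -> : box A = \big[setI/setT]_(i < n) ((@tnth n T)^~ i @^-1` A i).
  rewrite -bigcap_seq; apply/seteqP; split => t /= h i //.
    by move=> _; exact: h.
  by apply: h => /=; rewrite mem_index_enum.
apply: bigsetI_measurable => i _; rewrite -[X in measurable X]setTI.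
exact: measurable_tnth.
Qed.

Lemma tuple_measure_box n (A : 'I_n -> set T) :
  (forall i, measurable (A i)) ->
  tuple_measure mu n (box A) = \prod_(i < n) mu (A i).
Proof.
elim: n A => [|n IHn] A mA.
  by rewrite big_ord0 /= diracE mem_set// => -[].
rewrite big_ord_recl -IHn => [|i]; last exact: mA.
rewrite -product_measure1E//; last by apply: measurable_box => i; exact: mA.
rewrite /= /cons_measure /pushforward; congr (_ _).
apply/seteqP; split => -[x t] /=.
  move=> h; split; first exact: (h ord0).
  by move=> i; have := h (lift ord0 i); rewrite tnthS.
move=> [/= Ax h] i; case: (unliftP ord0 i) => [j|] ->; last exact: Ax.
by rewrite tnthS; exact: h.
Qed.

End tuple_measure_theory.

Section euclidean_space.
Context (R : realType) (d : nat).

Definition borel_vol : {sigma_finite_measure set _ -> \bar R} :=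
  tuple_measure (@lebesgue_measure R) d.

(* R^d with the sigma-algebra of Lebesgue measurable sets, i.e. the completion
   of the Borel sets for [borel_vol]. *)
Definition Rd := caratheodory_type (borel_vol^*)%mu.

HB.instance Definition _ := Measurable.on Rd.

Definition vol : set Rd -> \bar R := @completed_measure_extension _ _ _ borel_vol.

HB.instance Definition _ := Measure.on vol.

Let vol_sigma_finite : sigma_finite setT vol.
Proof. exact/completed_measure_extension_sigma_finite/sigma_finiteT. Qed.

HB.instance Definition _ :=
  @Measure_isSigmaFinite.Build _ _ _ vol vol_sigma_finite.

Definition coord (x : Rd) : 'I_d -> R := @tnth d R x.

Definition dist (x y : Rd) : R :=
  Num.sqrt (\sum_(i < d) (coord x i - coord y i) ^+ 2).

Definition origin : Rd := [tuple of nseq d 0].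

Definition closed_eball (x : Rd) (r : R) : set Rd := [set y | dist x y <= r].

Definition ebounded (S : set Rd) := exists M, forall x y, S x -> S y -> dist x y <= M.

(* For d > 0 exactly one r satisfies the predicate, so the default 0 of [xget]
   is not used. *)
Definition unit_vol_radius : R :=
  xget 0 [set r | 0 <= r /\ vol (closed_eball origin r) = 1%E].

Lemma measurable_coord i : measurable_fun setT (coord^~ i).
Proof.
move=> _ A mA; apply: caratheodory_measurable_mu_ext.
exact: (@measurable_tnth _ (measurableTypeR R) d i measurableT A mA).
Qed.

Lemma measurable_dist e (T : measurableType e) (f g : T -> Rd) :
  measurable_fun setT f -> measurable_fun setT g ->
  measurable_fun setT (fun t => dist (f t) (g t)).
Proof.
move=> mf mg; apply: (@measurableT_comp _ _ _ _ _ _ (@Num.sqrt R)).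
  by apply: continuous_measurable_fun; exact: sqrt_continuous.
apply: measurable_sum => i; apply: measurable_funX; apply: measurable_funB.
- exact: (measurableT_comp (measurable_coord i) mf).
- exact: (measurableT_comp (measurable_coord i) mg).
Qed.

End euclidean_space.

Definition config (T : choiceType) := {fset T}.

Definition config_display : measure_display -> measure_display.
Proof. exact. Qed.

Section config.
Context disp (T : measurableType disp).

HB.instance Definition _ := Pointed.copy (config T) {fset T}.

Definition points k (t : k.-tuple T) : config T := [fset x in tval t]%fset.

(* An event is measurable when, for each k, the k-tuples of points enumerating a
   configuration in the event form a measurable set: the largest sigma-algebra
   making every [points k] measurable. *)
Definition config_measurable : set (set (config T)) :=
  [set E | forall k, measurable (@points k @^-1` E)].

Let config_measurable0 : config_measurable set0.
Proof. by move=> k; rewrite preimage_set0; exact: measurable0. Qed.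

Let config_measurableC E : config_measurable E -> config_measurable (~` E).
Proof. by move=> mE k; rewrite preimage_setC; apply: measurableC; exact: mE. Qed.

Let config_measurable_bigcup (F : (set (config T))^nat) :
  (forall i, config_measurable (F i)) -> config_measurable (\bigcup_i F i).
Proof.
move=> mF k; rewrite preimage_bigcup; apply: bigcupT_measurable => i.
exact: mF.
Qed.

HB.instance Definition _ := @isMeasurable.Build (config_display disp) (config T)
  config_measurable config_measurable0 config_measurableC
  config_measurable_bigcup.

Lemma measurable_points k : measurable_fun setT (@points k).
Proof. by move=> _ E mE; rewrite setTI; exact: mE. Qed.

End config.

Section hard_sphere.
Context (R : realType) (d : nat).
Local Notation space := (Rd R d).
Local Notation volk := (tuple_measure (@vol R d)).

Definition hard_core k : set (k.-tuple space) :=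
  [set t | forall i j, i != j ->
    2 * unit_vol_radius R d < dist (tnth t i) (tnth t j)].

Lemma measurable_hard_core k : measurable (@hard_core k).
Proof.
have -> : @hard_core k = \big[setI/setT]_(i < k) \big[setI/setT]_(j < k | i != j)
    ((fun t : k.-tuple space => dist (tnth t i) (tnth t j)) @^-1`
      `]2 * unit_vol_radius R d, +oo[).
  apply/seteqP; split => t /=.
    move=> h; rewrite -bigcap_seq => i _ /=.
    rewrite -bigcap_seq_cond => j /= /andP[_ ij].
    by rewrite in_itv/= andbT; exact: h.
  rewrite -bigcap_seq => h i j ij.
  have := h i; rewrite /= mem_index_enum => /(_ isT).
  rewrite -bigcap_seq_cond => /(_ j) /=.
  by rewrite mem_index_enum ij => /(_ isT); rewrite in_itv/= andbT.
apply: bigsetI_measurable => i _; apply: bigsetI_measurable => j _.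
rewrite -[X in measurable X]setTI; apply: measurable_dist => //;
  exact: measurable_tnth.
Qed.

Variables (S : set space) (mS : measurable S).

Definition Zhat k : \bar R :=
  ((k`!%:R)^-1%:E * \int[volk k]_(t in box (fun=> S)) (\1_(@hard_core k) t)%:E)%E.

Definition partition_fun (l : R) : \bar R := (\sum_(0 <= k <oo) (l ^+ k)%:E * Zhat k)%E.

Lemma measurable_admissible k :
  measurable (box (fun=> S) `&` @hard_core k).
Proof.
by apply: measurableI; [exact: measurable_box|exact: measurable_hard_core].
Qed.

Section component.
Variable k : nat.

(* The law, under vol^k, of the set of points of a k-tuple in S^k with pairwise
   distances > 2 r_d. The proof of measurability is an argument only so that
   the measure instance below can be found. *)
Definition hs_component of measurable S := fun E : set (config space) =>
  volk k (@points _ _ k @^-1` E `&` (box (fun=> S) `&` @hard_core k)).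

Let hs_component0 : hs_component mS set0 = 0%E.
Proof. by rewrite /hs_component preimage_set0 set0I measure0. Qed.

Let hs_component_ge0 E : (0 <= hs_component mS E)%E.
Proof. by rewrite /hs_component measure_ge0. Qed.

Let hs_component_sigma_additive : semi_sigma_additive (hs_component mS).
Proof.
pose pm : {measure set _ -> \bar R} :=
  measure_function_pushforward__canonical__measure_function_Measure
    (mrestr (volk k) (@measurable_admissible k)) (@measurable_points _ space k).
exact: (@measure_semi_sigma_additive _ _ _ pm).
Qed.

HB.instance Definition _ := isMeasure.Build _ _ _ (hs_component mS)
  hs_component0 hs_component_ge0 hs_component_sigma_additive.

End component.

(* Weighting the k-point component by l^k / k! gives, up to the constant
   exp(-l vol S), the Poisson process of intensity l on S restricted to the
   configurations with pairwise distances > 2 r_d. *)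
Definition hs_weight (l : {posnum R}) : {measure set (config space) -> \bar R} :=
  mseries (fun k => mscale (l%:num ^+ k / k`!%:R)%:nng (hs_component k mS)) 0.

(* [mnormalize] takes a default law for weights of mass 0 or +oo; it is not used
   when S is bounded, see [hard_sphereE]. *)
Definition hard_sphere (l : {posnum R}) : probability (config space) R :=
  mnormalize (hs_weight l) \d_(fset0 : config space).

(* Both [fine]s are applied to finite quantities when S is bounded: a hard sphere
   configuration in a bounded set has a bounded number of points. *)
Definition packing_density (l : {posnum R}) : R :=
  fine ('E_(hard_sphere l)[fun X => #|` X|%:R]) / fine (vol S).

End hard_sphere.

Section hard_sphere_theory.
Context (R : realType) (d : nat).
Local Notation space := (Rd R d).
Local Notation volk := (tuple_measure (@vol R d)).
Implicit Types (S : set space) (l : {posnum R}).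

Lemma dist_ge0 (x y : space) : 0 <= dist x y.
Proof. exact: sqrtr_ge0. Qed.

Lemma dist_coord (x y : space) i : `|coord x i - coord y i| <= dist x y.
Proof.
rewrite -sqrtr_sqr ler_wsqrtr// (bigD1 i)//= lerDl sumr_ge0// => j _.
exact: sqr_ge0.
Qed.

Lemma unit_vol_radius_ge0 : 0 <= unit_vol_radius R d.
Proof. by rewrite /unit_vol_radius; case: xgetP => // r _ []. Qed.

Lemma vol_borel (A : set space) :
  (measurable : set (set (d.-tuple (measurableTypeR R)))) A ->
  vol A = borel_vol R d A.
Proof. by move=> mA; rewrite /vol /completed_measure_extension measurable_mu_extE. Qed.

Lemma vol_ebounded S : measurable S -> ebounded S -> (vol S < +oo)%E.
Proof.
move=> mS [M bM]; have [->|/set0P[x Sx]] := eqVneq S set0.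
  by rewrite measure0.
pose A (i : 'I_d) : set (measurableTypeR R) := `[coord x i - M, coord x i + M]%classic.
have mA i : measurable (A i) by exact: measurable_itv.
have mB : (measurable : set (set (d.-tuple (measurableTypeR R)))) (box A).
  exact: measurable_box.
apply: (@le_lt_trans _ _ (vol (box A))).
  apply: le_measure; rewrite ?inE//.
    exact: caratheodory_measurable_mu_ext.
  move=> y Sy i; rewrite /A /= in_itv/=.
  have := le_trans (dist_coord x y i) (bM _ _ Sx Sy).
  by rewrite ler_norml /coord => /andP[]; rewrite !lerBrDl !lerBlDl; lra.
rewrite vol_borel// [X in (X < _)%E](tuple_measure_box _ mA).
have muA i : lebesgue_measure (A i) = (fine (lebesgue_measure (A i)))%:E.
  by rewrite fineK// /A lebesgue_measure_itv/=; case: ifP => _; rewrite ?fin_numD.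
by rewrite (eq_bigr _ (fun i _ => muA i)) prodEFin ltry.
Qed.

Lemma points_card k (t : k.-tuple space) :
  hard_core t -> #|` points t| = k.
Proof.
move=> ht; rewrite card_fseq undup_id ?size_tuple//.
apply/tuple_uniqP => i j tij; apply/eqP/negPn/negP => ij.
have := ht _ _ ij; rewrite tij /dist.
under eq_bigr do rewrite subrr expr0n.
by rewrite big1// sqrtr0 ltNge mulr_ge0// unit_vol_radius_ge0.
Qed.

Lemma ZhatE S k : measurable S ->
  Zhat S k = ((k`!%:R)^-1%:E * volk k (box (fun=> S) `&` @hard_core R d k))%E.
Proof.
move=> mS; rewrite /Zhat integral_indic//.
- by rewrite setIC.
- exact: measurable_box.
- exact: measurable_hard_core.
Qed.

Lemma Zhat_ge0 S k : (0 <= Zhat S k)%E.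
Proof.
rewrite mule_ge0 ?lee_fin ?invr_ge0//; apply: integral_ge0 => t _.
by rewrite lee_fin.
Qed.

Lemma Zhat0 S : measurable S -> Zhat S 0 = 1%E.
Proof.
move=> mS; rewrite ZhatE// fact0 invr1 mul1e.
by rewrite /= diracE mem_set//; split=> -[].
Qed.

Lemma Zhat_le S k : measurable S ->
  (Zhat S k <= (k`!%:R)^-1%:E * vol S ^+ k)%E.
Proof.
move=> mS; rewrite ZhatE// lee_wpmul2l ?lee_fin ?invr_ge0//.
apply: (@le_trans _ _ (volk k (box (fun=> S)))).
  by apply: measureIl; [exact: measurable_box|exact: measurable_hard_core].
rewrite tuple_measure_box//; elim: k => [|k IHk]; first by rewrite big_ord0.
by rewrite big_ord_recl expeS lee_wpmul2l.
Qed.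

Lemma partition_fun_gt0 S l : measurable S -> (0 < partition_fun S l%:num)%E.
Proof.
move=> mS; rewrite /partition_fun (@nneseriesD1 _ _ 0%N)//; last first.
  by move=> k _; rewrite mule_ge0 ?lee_fin ?Zhat_ge0.
rewrite expr0 mul1e Zhat0// (@lt_le_trans _ _ 1%E)// leeDl//.
by apply: nneseries_ge0 => k _ _; rewrite mule_ge0 ?lee_fin ?Zhat_ge0.
Qed.

Lemma partition_fun_lty S l : measurable S -> ebounded S -> (partition_fun S l%:num < +oo)%E.
Proof.
move=> mS bS; have Sfin : vol S \is a fin_num.
  by rewrite ge0_fin_numE ?vol_ebounded.
apply: (@le_lt_trans _ _
    (\sum_(0 <= k <oo) (exp_coeff (l%:num * fine (vol S)) k)%:E)%E).
  apply: lee_nneseries => k _; first by rewrite mule_ge0 ?lee_fin ?Zhat_ge0.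
  apply: (@le_trans _ _ ((l%:num ^+ k)%:E * ((k`!%:R)^-1%:E * vol S ^+ k))%E).
    by rewrite lee_wpmul2l ?lee_fin ?Zhat_le.
  by rewrite -(fineK Sfin) -EFin_expe -!EFinM lee_fin /exp_coeff/= exprMn mulrCA mulrC.
rewrite (_ : (\sum_(0 <= k <oo) _)%E = (expR (l%:num * fine (vol S)))%:E) ?ltry//.
rewrite /expR -EFin_lim; last exact: is_cvg_series_exp_coeff.
by apply/congr_lim/funext => n /=; rewrite /series/= -sumEFin.
Qed.

Lemma hs_weight_card S (mS : measurable S) l k :
  hs_weight mS l [set X | #|` X| = k] = ((l%:num ^+ k)%:E * Zhat S k)%E.
Proof.
rewrite /hs_weight/= /mseries (@nneseriesD1 _ _ k)//.
rewrite eseries0 ?adde0 => [|j _ /= jk]; last first.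
  rewrite /mscale/= /hs_component (_ : _ `&` _ = set0) ?measure0 ?mule0//.
  apply/seteqP; split => // t [/= tk [_ ht]].
  by move: jk; rewrite -tk points_card// eqxx.
rewrite /mscale/= /hs_component ZhatE// muleA -EFinM; congr (_ * volk k _)%E.
by apply: setIidr => t [_ /= ht]; exact: points_card.
Qed.

Lemma hs_weight_setT S (mS : measurable S) l :
  hs_weight mS l setT = partition_fun S l%:num.
Proof.
rewrite /hs_weight/= /mseries; apply: eq_eseriesr => k _.
rewrite /mscale /= /hs_component ZhatE// muleA -EFinM; congr (_ * volk k _)%E.
by rewrite preimage_setT setTI.
Qed.

Lemma hard_sphereE S (mS : measurable S) l (E : set (config space)) :
  ebounded S ->
  hard_sphere mS l E = (hs_weight mS l E * (fine (partition_fun S l%:num))^-1%:E)%E.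
Proof.
move=> bS; rewrite /hard_sphere /= /mnormalize hs_weight_setT.
by rewrite gt_eqF ?partition_fun_gt0// lt_eqF ?partition_fun_lty.
Qed.

Lemma hard_sphere_card S (mS : measurable S) l k : ebounded S ->
  hard_sphere mS l [set X | #|` X| = k] =
  ((l%:num ^+ k)%:E * Zhat S k * (fine (partition_fun S l%:num))^-1%:E)%E.
Proof. by move=> bS; rewrite hard_sphereE// hs_weight_card. Qed.

End hard_sphere_theory.

(* Main.v *)
Require Import Defs.
From HB Require Import structures.
From mathcomp Require Import all_boot all_order all_algebra.
From mathcomp Require Import finmap.
From mathcomp Require Import all_classical all_reals all_analysis.
From mathcomp Require Import measurable_realfun ring lra.

(** Write Z_A for the partition function of a measurable set A, B(x) for the
    ball of radius 2 r_d about x, and N_A = l * int_A Z_{A \ B(x)} dx, so that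
    E|X| = N_S / Z_S.

    If A lies in a ball of radius 2 r_d, then int_A vol (A /\ B(x)) dx is at
    most K vol A with K = 2 * 3^(d/2): of two points of A within 2 r_d of each
    other, the one nearer to the centre of the ball lies in a ball of radius
    sqrt 3 * r_d determined by the other one. Since
    Z_A <= exp (l vol (A /\ B(x))) Z_{A \ B(x)}, this gives
    N_A >= (1 - l K) l vol A Z_A, and as Z_A <= exp (l vol A), the tangent lines
    of z log z turn it into the linear inequality
    N_A + (1 - l K) e^(c-1) >= (1 - l K) c Z_A for all real c.

    Given the configuration outside B(v), the one inside is a hard sphere
    configuration on the part of S /\ B(v) left uncovered. So the linear
    inequality may be summed over the outer configurations, and integrated over
    v in S, where each point of S lies in balls B(v) of total measure at most
    2^d. The result bounds E|X| from below; take l = 3^(-d/2) / d and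
    e^(c-1) = l 2^d / d. Larger fugacities follow as E|X| increases with l. *)

Set Implicit Arguments.
Unset Strict Implicit.
Unset Printing Implicit Defensive.

Import Order.TTheory GRing.Theory Num.Theory.
Import numFieldNormedType.Exports.

Local Open Scope classical_set_scope.
Local Open Scope ring_scope.

(** * Integrals over sections *)

Lemma integral_mkcond0 d (T : measurableType d) (R : realType)
  (m : {measure set T -> \bar R})
  (A : set T) (f : T -> \bar R) :
  (forall x, ~ A x -> f x = 0%E) -> (\int[m]_(x in A) f x = \int[m]_x f x)%E.
Proof.
move=> f0; rewrite integral_mkcond; apply: eq_integral => x _.
by rewrite patchE; case: ifPn => // /negP; rewrite inE => /f0.
Qed.

Section section_integrals.
Local Open Scope ereal_scope.
Context d1 d2 (T1 : measurableType d1) (T2 : measurableType d2) (R : realType).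
Variable m2 : {sigma_finite_measure set T2 -> \bar R}.
Variables (U : set (T1 * T2)) (G : T1 * T2 -> \bar R).

Lemma integral_sectionE x : \int[m2]_(y in xsection U x) G (x, y) =
  \int[m2]_y (G \_ U) (x, y).
Proof.
rewrite integral_mkcond; apply: eq_integral => y _.
by rewrite !patchE mem_xsection.
Qed.

Hypothesis mU : measurable U.
Hypothesis mG : measurable_fun setT G.
Hypothesis G0 : forall p, 0 <= G p.

Lemma measurable_restrict_pair : measurable_fun setT (G \_ U).
Proof. by apply/(measurable_restrictT _ mU); exact: measurable_funS mG. Qed.

Lemma restrict_pair_ge0 p : 0 <= (G \_ U) p.
Proof. by rewrite patchE; case: ifP. Qed.

Lemma measurable_integral_section :
  measurable_fun setT (fun x => \int[m2]_(y in xsection U x) G (x, y)).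
Proof.
under eq_fun do rewrite integral_sectionE.
apply: (measurable_fun_fubini_tonelli_F (fun p => _) measurable_restrict_pair).
exact: restrict_pair_ge0.
Qed.

End section_integrals.

Section fubini_sections.
Local Open Scope ereal_scope.
Context d1 d2 (T1 : measurableType d1) (T2 : measurableType d2) (R : realType).
Variable m1 : {sigma_finite_measure set T1 -> \bar R}.
Variable m2 : {sigma_finite_measure set T2 -> \bar R}.
Variables (U : set (T1 * T2)) (G : T1 * T2 -> \bar R).
Hypothesis mU : measurable U.
Hypothesis mG : measurable_fun setT G.
Hypothesis G0 : forall p, 0 <= G p.

(** Tonelli for [G] restricted to [U]. Outside [A] and [B] the sections of [U] are empty, so
    restricting the outer integrals to them changes nothing. *)
Lemma fubini_section (A : set T1) (B : set T2) :
  (forall x y, U (x, y) -> A x /\ B y) ->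
  \int[m1]_(x in A) \int[m2]_(y in xsection U x) G (x, y) =
  \int[m2]_(y in B) \int[m1]_(x in ysection U y) G (x, y).
Proof.
move=> UAB; rewrite integral_mkcond0; last first.
  move=> x Ax; rewrite (_ : xsection _ _ = set0) ?integral_set0//.
  apply/seteqP; split => // y /=; rewrite /xsection/= inE.
  by move=> /UAB[].
rewrite [RHS]integral_mkcond0; last first.
  move=> x Ax; rewrite (_ : ysection _ _ = set0) ?integral_set0//.
  apply/seteqP; split => // y /=; rewrite /ysection/= inE.
  by move=> /UAB[].
under eq_integral do rewrite integral_sectionE.
rewrite (fubini_tonelli _ (measurable_restrict_pair mU mG)); last first.
  exact: restrict_pair_ge0.
apply: eq_integral => y _; rewrite [RHS]integral_mkcond; apply: eq_integral => x _.
by rewrite !patchE mem_ysection.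
Qed.

End fubini_sections.

(** * Integrals over packings *)

Section exclusion.
Local Open Scope ereal_scope.
Context d (T : measurableType d) (R : realType).
Variable mu : {sigma_finite_measure set T -> \bar R}.
Variable E : set (T * T).
Implicit Types (A B : set T) (F G : set T -> \bar R).

Definition avoid A (x : T) : set T := A `\` xsection E x.

(* The integral of [F], applied to the part of [A] left uncovered, over the
   ordered j-point packings in [B] ([E] is the relation of being too close). *)
Fixpoint insert F j A B : \bar R :=
  if j is j'.+1 then \int[mu]_(y in B) insert F j' (avoid A y) (avoid B y)
  else F A.

(* Measurability of set functions along every measurable family of sets lets
   the iterated integrals defining [insert] be handled by induction on [j],
   adding one parameter at a time. *)
Definition measurable_functional F := (forall A, 0 <= F A) /\
  forall d' (O : measurableType d') (W : set (O * T)), measurable W ->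
    measurable_fun setT (fun w => F (xsection W w)).

(** Makes the inserted point part of the parameter, so that the sets left after one insertion again
    form a measurable family. *)
Definition avoid_family d' (O : measurableType d') (W : set (O * T)) :
  set (O * T * T) := [set p | W (p.1.1, p.2) /\ ~ E (p.1.2, p.2)].

Lemma xsection_avoid_family d' (O : measurableType d') (W : set (O * T)) p :
  xsection (avoid_family W) p = avoid (xsection W p.1) p.2.
Proof. by rewrite /avoid !xsectionE; apply/seteqP; split => z. Qed.

Lemma insert_ge0 F j A B : (forall A, 0 <= F A) -> 0 <= insert F j A B.
Proof.
by move=> F0; elim: j A B => //= j IH A B; exact: integral_ge0.
Qed.

Lemma avoidU A B x : avoid (A `|` B) x = avoid A x `|` avoid B x.
Proof. exact: setDUl. Qed.

Lemma avoidC A x y : avoid (avoid A x) y = avoid (avoid A y) x.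
Proof. by rewrite /avoid setDDl setUC -setDDl. Qed.

Lemma avoid_sub A x : avoid A x `<=` A.
Proof. exact: subDsetl. Qed.

Hypothesis mE : measurable E.

Lemma measurable_avoid A x : measurable A -> measurable (avoid A x).
Proof. by move=> mA; apply: measurableD => //; exact: measurable_xsection. Qed.
#[local] Hint Resolve measurable_avoid : core.

Lemma measurable_avoid_family d' (O : measurableType d') (W : set (O * T)) :
  measurable W -> measurable (avoid_family W).
Proof.
move=> mW; rewrite (_ : avoid_family _ =
  ((fun p : O * T * T => (p.1.1, p.2)) @^-1` W) `&`
  ((fun p : O * T * T => (p.1.2, p.2)) @^-1` ~` E)) //.
have m1 : measurable_fun setT (@fst (O * T)%type T) by exact: measurable_fst.
have m2 : measurable_fun setT (@snd (O * T)%type T) by exact: measurable_snd.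
apply: measurableI; rewrite -[X in measurable X]setTI;
  apply: measurable_fun_pair => //; try exact: measurableC.
- exact: (measurableT_comp measurable_fst m1).
- exact: (measurableT_comp measurable_snd m1).
Qed.

Lemma measurable_insert F j d' (O : measurableType d') (W V : set (O * T)) :
  measurable_functional F -> measurable W -> measurable V ->
  measurable_fun setT (fun w => insert F j (xsection W w) (xsection V w)).
Proof.
move=> [F0 mF]; elim: j d' O W V => [|j IH] d' O W V mW mV; first exact: mF.
have mG := IH _ _ _ _ (measurable_avoid_family mW) (measurable_avoid_family mV).
have := measurable_integral_section mu mV mG (fun=> insert_ge0 j _ _ F0).
apply: eq_measurable_fun => w _ /=; apply: eq_integral => y _.
by rewrite !xsection_avoid_family.
Qed.

Lemma measurable_insert_avoid F j A B :
  measurable_functional F -> measurable A -> measurable B ->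
  measurable_fun setT (fun x => insert F j (avoid A x) (avoid B x)).
Proof.
move=> mF mA mB.
have mV (C : set T) : measurable C ->
    measurable ([set p | C p.2 /\ ~ E p] : set (T * T)).
  move=> mC; rewrite (_ : mkset _ = (setT `*` C) `\` E).
    by apply: measurableD => //; exact: measurableX.
  by apply/seteqP; split=> -[x y] /= => [[? ?]|[[_ ?] ?]].
apply: eq_measurable_fun (measurable_insert j mF (mV _ mA) (mV _ mB)) => x _.
by rewrite /avoid !xsectionE.
Qed.

Lemma measurable_functional_avoid F A :
  measurable_functional F -> measurable A ->
  measurable_fun setT (fun x => F (avoid A x)).
Proof. by move=> mF mA; exact: (@measurable_insert_avoid F 0 A A). Qed.

Section linearity.
Variables (A B : set T) (mA : measurable A) (mB : measurable B).

Lemma insertD F G j : measurable_functional F -> measurable_functional G ->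
  insert (fun C => F C + G C) j A B = insert F j A B + insert G j A B.
Proof.
move=> mF mG; elim: j A B mA mB => //= j IH C D mC mD.
rewrite -ge0_integralD//.
- by apply: eq_integral => y _; rewrite IH//; exact: measurable_avoid.
- by move=> *; exact: insert_ge0 mF.1.
- by apply: measurable_funTS; exact: measurable_insert_avoid.
- by move=> *; exact: insert_ge0 mG.1.
- by apply: measurable_funTS; exact: measurable_insert_avoid.
Qed.

Lemma insertZ F (c : R) j : (0 <= c)%R -> measurable_functional F ->
  insert (fun C => c%:E * F C) j A B = c%:E * insert F j A B.
Proof.
move=> c0 mF; elim: j A B mA mB => //= j IH C D mC mD.
rewrite -ge0_integralZl//.
- by apply: eq_integral => y _; rewrite IH//; exact: measurable_avoid.
- by apply: measurable_funTS; exact: measurable_insert_avoid.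
- by move=> *; exact: insert_ge0 mF.1.
Qed.

Lemma insert_series (F : nat -> set T -> \bar R) j :
  (forall m, measurable_functional (F m)) ->
  insert (fun C => \sum_(0 <= m <oo) F m C) j A B =
  \sum_(0 <= m <oo) insert (F m) j A B.
Proof.
move=> mF; elim: j A B mA mB => //= j IH C D mC mD.
rewrite -integral_nneseries//.
- by apply: eq_integral => y _; rewrite IH//; exact: measurable_avoid.
- by move=> *; apply: measurable_funTS; exact: measurable_insert_avoid.
- by move=> m *; exact: insert_ge0 (mF m).1.
Qed.

(** Inserting points only shrinks the first argument, so comparing [F] and [G] on subsets of [A] is
    enough. This matters because the local inequality holds only inside one ball. *)
Lemma insert_le F G j : measurable_functional F -> measurable_functional G ->
  (forall C, measurable C -> C `<=` A -> F C <= G C) ->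
  insert F j A B <= insert G j A B.
Proof.
move=> mF mG; elim: j A B mA mB => //= [|j IH] C D mC mD FG; first exact: FG.
apply: ge0_le_integral => //.
- by move=> *; exact: insert_ge0 mF.1.
- by apply: measurable_funTS; exact: measurable_insert_avoid.
- by apply: measurable_funTS; exact: measurable_insert_avoid.
- move=> y _; apply: IH; try exact: measurable_avoid.
  by move=> X mX XC; apply: FG => //; apply: subset_trans XC _; exact: avoid_sub.
Qed.

End linearity.

(** For the partition function Z, [l * peel Z A] is the quantity N_A. *)
Definition peel F A : \bar R := \int[mu]_(x in A) F (avoid A x).

Lemma measurable_peel F : measurable_functional F -> measurable_functional (peel F).
Proof.
move=> mF; split=> [A|d' O W mW]; first by apply: integral_ge0 => *; exact: mF.1.
exact: (@measurable_insert F 1 _ _ _ _ mF mW mW).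
Qed.

Hypothesis symE : forall x y, E (x, y) -> E (y, x).

(** Both sides integrate [G] over the pairs of [A * B] outside [E]; symmetry of [E] lets either
    point be the one that excludes the other. *)
Lemma integral_avoid_swap (G : T * T -> \bar R) A B :
  measurable A -> measurable B ->
  measurable_fun setT G -> (forall p, 0 <= G p) ->
  \int[mu]_(x in A) \int[mu]_(y in avoid B x) G (x, y) =
  \int[mu]_(y in B) \int[mu]_(x in avoid A y) G (x, y).
Proof.
move=> mA mB mG G0; pose U := (A `*` B) `\` E.
have mU : measurable U by apply: measurableD => //; exact: measurableX.
transitivity (\int[mu]_(x in A) \int[mu]_(y in xsection U x) G (x, y)).
  apply: eq_integral => x /[!inE] Ax; congr (integral _ _ _).
  by rewrite /avoid !xsectionE; apply/seteqP; split=> y /= => [[]|[[]]].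
rewrite (fubini_section mu mu mU mG G0 (B := B)); last by move=> x y /= [[]].
apply: eq_integral => y /[!inE] By; congr (integral _ _ _).
rewrite /avoid xsectionE ysectionE; apply/seteqP; split=> x /=.
  by move=> [[? ?] H]; split => // /symE.
by move=> [? H]; split => // /symE.
Qed.

(** The point [x] of [A], chosen before the [j] points of [B], is exchanged with them one at a time
    by [integral_avoid_swap] until it is chosen last, from what they leave uncovered of [A]. *)
Lemma insert_peel F j A B : measurable_functional F ->
  measurable A -> measurable B ->
  \int[mu]_(x in A) insert F j (avoid A x) (avoid B x) = insert (peel F) j A B.
Proof.
move=> mF; elim: j A B => //= j IH A B mA mB.
(* The exchange needs the integrand to be jointly measurable in the two points, so [C] with both
   balls removed is written as a section of one measurable set. *)
pose V (C : set T) := [set p : T * T * T | [/\ C p.2, ~ E (p.1.1, p.2) & ~ E (p.1.2, p.2)]].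
have VE (C : set T) p : xsection (V C) p = avoid (avoid C p.1) p.2.
  by rewrite /avoid !xsectionE; apply/seteqP; split => z /= [] => [|[]].
have mV C : measurable C -> measurable (V C).
  move=> mC; rewrite (_ : V C = avoid_family ((setT `*` C) `\` E)).
    by apply: measurable_avoid_family; apply: measurableD => //; exact: measurableX.
  by apply/seteqP; split => -[[x y] z] /= => [[]|[[[]]]].
have := @integral_avoid_swap (fun p => insert F j (xsection (V A) p) (xsection (V B) p)) _ _ mA mB.
under eq_integral do under eq_integral do rewrite !VE/=.
move=> ->; last 2 first.
- by apply: measurable_insert => //; exact: mV.
- by move=> p; exact: insert_ge0 mF.1.
apply: eq_integral => y _; rewrite -IH; try exact: measurable_avoid.
by apply: eq_integral => x _; rewrite !VE/= (avoidC A) (avoidC B).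
Qed.

End exclusion.

(** * Partition functions *)

Lemma nneseries_triangle (R : realType) (b : nat -> nat -> \bar R) :
  (forall m j, 0 <= b m j)%E ->
  (\sum_(0 <= n <oo) \sum_(j < n.+1) b (n - j)%N j =
   \sum_(0 <= j <oo) \sum_(0 <= m <oo) b m j)%E.
Proof.
(* Extension by zero above the diagonal turns the triangle into a full double series, whose order of
   summation can be exchanged. *)
move=> b0; pose u n j : \bar R := if (j <= n)%N then b (n - j)%N j else 0%E.
have u0 n j : (0 <= u n j)%E by rewrite /u; case: ifP.
transitivity (\sum_(0 <= n <oo) \sum_(0 <= j <oo) u n j)%E.
  apply: eq_eseriesr => n _; rewrite (nneseries_split 0 n.+1)//.
  rewrite eseries0 ?adde0 => [|j nj _]; last by rewrite /u leqNgt nj.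
  rewrite add0n big_mkord; apply: eq_bigr => j _.
  by rewrite /u -ltnS ltn_ord.
rewrite nneseries_interchange//; apply: eq_eseriesr => j _.
rewrite (nneseries_split 0 j)// big_nat big1 ?add0e => [|i /andP[_ ij]]; last first.
  by rewrite /u leqNgt ij.
rewrite -nneseries_addn//; apply: eq_eseriesr => i _.
by rewrite /u leq_addl addnK.
Qed.

Section partition_function.
Local Open Scope ereal_scope.
Context d (T : measurableType d) (R : realType).
Variable mu : {sigma_finite_measure set T -> \bar R}.
Variable E : set (T * T).
Hypothesis mE : measurable E.
Hypothesis symE : forall x y, E (x, y) -> E (y, x).
Implicit Types (A B : set T) (F G : set T -> \bar R).
Local Notation avoid := (avoid E).
Local Notation insert := (insert mu E).
Local Notation measurable_functional := (@measurable_functional _ T R).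
Local Notation peel := (peel mu E).

Definition packing_integral n A : \bar R := insert (fun=> 1) n A A.
Local Notation Q := packing_integral.

Lemma insert1E n A B : insert (fun=> 1) n A B = Q n B.
Proof.
suff H C : insert (fun=> 1) n A B = insert (fun=> 1) n C B by exact: H.
by elim: n A B C => //= n IH A B C; apply: eq_integral => y _; exact: IH.
Qed.

Lemma measurable_functional1 : measurable_functional (fun=> 1).
Proof. by split => // ? ? ? _; exact: measurable_cst. Qed.
#[local] Hint Resolve measurable_functional1 : core.

Lemma measurable_Q n : measurable_functional (Q n).
Proof.
split=> [A|d' O W mW]; first exact: insert_ge0.
exact: measurable_insert.
Qed.
#[local] Hint Resolve measurable_Q : core.

Lemma Q_ge0 n A : 0 <= Q n A. Proof. exact: (measurable_Q n).1. Qed.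

Lemma QS n A : Q n.+1 A = peel (Q n) A. Proof. by []. Qed.

(** Here [j] counts the points in [B]: the binomial coefficient chooses their places in the ordered
    packing, and the others form a packing of what they leave uncovered of [A]. The induction looks
    at where the first point falls. *)
Lemma Q_setU n A B : measurable A -> measurable B -> [disjoint A & B] ->
  Q n (A `|` B) = \sum_(j < n.+1) 'C(n, j)%:R%:E * insert (Q (n - j)) j A B.
Proof.
elim: n A B => [|n IH] A B mA mB AB.
  by rewrite big_ord1 bin0 mul1e.
rewrite QS /peel.
have disj x : [disjoint avoid A x & avoid B x].
  apply/disj_set2P/seteqP; split => // y [[Ay _] [By _]].
  by move/disj_set2P : AB => <-.
have mf C x : measurable C -> measurable (avoid C x) by exact: measurable_avoid.
rewrite ge0_integral_setU//; last 2 first.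
- apply: measurable_funTS; apply: measurable_functional_avoid => //.
  exact: measurableU.
- by move=> x _; exact: Q_ge0.
have IHx x : Q n (avoid (A `|` B) x) =
    \sum_(j < n.+1) 'C(n, j)%:R%:E * insert (Q (n - j)) j (avoid A x) (avoid B x).
  by rewrite avoidU IH//; exact: mf.
under eq_integral do rewrite IHx.
under [X in _ + X]eq_integral do rewrite IHx.
have mI j : measurable_fun setT (fun x => 'C(n, j)%:R%:E *
    insert (Q (n - j)) j (avoid A x) (avoid B x)).
  by apply: measurable_funeM; exact: measurable_insert_avoid.
have I0 j x : 0 <= insert (Q (n - j)) j (avoid A x) (avoid B x).
  by apply: insert_ge0; exact: Q_ge0.
rewrite !ge0_integral_sum//=; try by move=> *; apply: mule_ge0;
  rewrite ?lee_fin.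
all: try by move=> *; apply: measurable_funTS.
(* First point in [A]: [insert_peel] moves it behind the [j] points of [B], so the number of points
   in [A] grows by one. *)
rewrite (_ : \sum_(i < n.+1) _ =
    \sum_(j < n.+1) 'C(n, j)%:R%:E * insert (Q (n.+1 - j)) j A B); last first.
  apply: eq_bigr => -[j /= jn] _; rewrite ge0_integralZl//.
    by rewrite subSn// insert_peel.
  by apply: measurable_funTS; exact: measurable_insert_avoid.
(* First point in [B]: it is one more inserted point. *)
rewrite [X in _ + X](_ : _ =
    \sum_(j < n.+1) 'C(n, j)%:R%:E * insert (Q (n - j)) j.+1 A B); last first.
  apply: eq_bigr => -[j /= jn] _; rewrite ge0_integralZl//.
  by apply: measurable_funTS; exact: measurable_insert_avoid.
pose a j := insert (Q (n.+1 - j)) j A B.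
have a0 j : 0 <= a j by apply: insert_ge0; exact: Q_ge0.
rewrite -/(a _) [RHS]big_ord_recl.
(* Pascal's rule for the terms of index at least 1. The surplus last term carries C(n, n+1) = 0. *)
rewrite [X in _ = _ + X](_ : _ = \sum_(j < n.+1) 'C(n, j.+1)%:R%:E * a j.+1 +
   \sum_(j < n.+1) 'C(n, j)%:R%:E * a j.+1); last first.
  rewrite -big_split; apply: eq_bigr => j _ /=.
  by rewrite /bump leq0n add1n binS natrD EFinD ge0_muleDl.
rewrite addeA; congr (_ + _).
rewrite big_ord_recl/= bin0 mul1e [X in _ = _ + X]big_ord_recr/=.
by rewrite bin_small// mul0e adde0.

Qed.

Variable l : R.
Hypothesis l0 : (0 <= l)%R.

Definition coeff n : R := (l ^+ n / n`!%:R)%R.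

Lemma coeff_ge0 n : (0 <= coeff n)%R.
Proof. by rewrite divr_ge0// exprn_ge0. Qed.
#[local] Hint Resolve coeff_ge0 : core.

(* The sum of [F] (uncovered part of [A]) over the configurations in [B]: the
   spatial Markov property is [Z_setU] below. *)
Definition exterior F A B : \bar R := \sum_(0 <= j <oo) (coeff j)%:E * insert F j A B.

Definition gas_partition A : \bar R := exterior (fun=> 1) A A.
Local Notation Z := gas_partition.

Lemma ZE A : Z A = \sum_(0 <= n <oo) (coeff n)%:E * Q n A. Proof. by []. Qed.

Lemma exterior1 A B : exterior (fun=> 1) A B = Z B.
Proof. by apply: eq_eseriesr => j _; rewrite insert1E. Qed.

Lemma measurable_functionalZ (c : R) F : (0 <= c)%R ->
  measurable_functional F -> measurable_functional (fun A => c%:E * F A).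
Proof.
move=> c0 mF; split=> [A|d' O W mW]; first by rewrite mule_ge0//; exact: mF.1.
by apply: measurable_funeM; exact: mF.2.
Qed.

Lemma measurable_Z : measurable_functional Z.
Proof.
split=> [A|d' O W mW].
  by apply: nneseries_ge0 => n _ _; rewrite mule_ge0 ?lee_fin ?Q_ge0.
apply: ge0_emeasurable_sum => n *; first by rewrite mule_ge0 ?lee_fin ?Q_ge0.
by apply: measurable_funeM; exact: (measurable_Q n).2.
Qed.

Lemma Z_ge1 A : 1 <= Z A.
Proof.
rewrite ZE nneseries_recl//; last by move=> n; rewrite mule_ge0 ?lee_fin ?Q_ge0.
rewrite (_ : coeff 0 = 1%R) ?mul1e ?leeDl//; last first.
  by rewrite /coeff expr0 fact0 divr1.
by apply: nneseries_ge0 => n _ _; rewrite mule_ge0 ?lee_fin ?Q_ge0.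
Qed.

(** C(n, j) l^n / n! factors as [coeff (n - j) * coeff j], so [Q_setU] gives a double series indexed
    by the numbers of points in [A] and in [B]. Summing first over the points in [A] rebuilds Z of
    the uncovered part. *)
Lemma Z_setU A B : measurable A -> measurable B -> [disjoint A & B] ->
  Z (A `|` B) = exterior Z A B.
Proof.
move=> mA mB AB; rewrite ZE.
pose b m j := (coeff m * coeff j)%:E * insert (Q m) j A B.
have b0 m j : 0 <= b m j.
  apply: mule_ge0; first by rewrite lee_fin mulr_ge0.
  by apply: insert_ge0; exact: Q_ge0.
transitivity (\sum_(0 <= n <oo) \sum_(j < n.+1) b (n - j)%N j).
  apply: eq_eseriesr => n _; rewrite Q_setU// ge0_sume_distrr; last first.
    by move=> j _; rewrite mule_ge0 ?lee_fin//; apply: insert_ge0; exact: Q_ge0.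
  apply: eq_bigr => -[j /= jn] _; rewrite muleA -EFinM /b; congr (_%:E * _).
  have jn' : (j <= n)%N by [].
  rewrite /coeff -(bin_fact jn') !natrM (_ : l ^+ n = l ^+ (n - j) * l ^+ j)%R.
    by field; rewrite !pnatr_eq0 -!lt0n !fact_gt0 bin_gt0 jn'.
  by rewrite -exprD subnK.
rewrite nneseries_triangle//; apply: eq_eseriesr => j _.
rewrite (insert_series mu mE) => [|//|//|m]; last first.
  exact: (@measurable_functionalZ (coeff m) (Q m)).
rewrite -nneseriesZl; last first.
  by move=> m _; apply: insert_ge0; exact: (@measurable_functionalZ (coeff m) (Q m) _ _).1.
apply: eq_eseriesr => m _; rewrite (insertZ mu mE)//; last exact: measurable_Q.
by rewrite /b muleA -EFinM [X in X%:E]mulrC.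
Qed.

End partition_function.

(** * Bounds inside a ball *)

Section fugacity_bounds.
Local Open Scope ereal_scope.
Context d (T : measurableType d) (R : realType).
Variable mu : {sigma_finite_measure set T -> \bar R}.
Variable E : set (T * T).
Hypothesis mE : measurable E.
Hypothesis symE : forall x y, E (x, y) -> E (y, x).
Variable l : R.
Hypothesis l0 : (0 <= l)%R.
Implicit Types (A B : set T) (F G : set T -> \bar R).
Local Notation avoid := (avoid E).
Local Notation insert := (insert mu E).
Local Notation measurable_functional := (@measurable_functional _ T R).
Local Notation peel := (peel mu E).
Local Notation Q := (packing_integral mu E).
Local Notation coeff := (coeff l).
Local Notation exterior := (exterior mu E l).
Local Notation Z := (gas_partition mu E l).

Let coeff_ge0' n : (0 <= coeff n)%R. Proof. exact: coeff_ge0. Qed.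
#[local] Hint Resolve coeff_ge0' : core.
Let mZ : measurable_functional Z. Proof. exact: measurable_Z. Qed.
#[local] Hint Resolve mZ : core.
Let Z0 A : 0 <= Z A. Proof. exact: mZ.1. Qed.
#[local] Hint Resolve Z0 : core.
Let mavoid A x : measurable A -> measurable (avoid A x).
Proof. exact: measurable_avoid. Qed.
#[local] Hint Resolve mavoid : core.

Let insert0 F j A B : measurable_functional F -> 0 <= insert F j A B.
Proof. by move=> mF; apply: insert_ge0; exact: mF.1. Qed.
Let term0 F j A B : measurable_functional F -> 0 <= (coeff j)%:E * insert F j A B.
Proof. by move=> mF; apply: mule_ge0; [rewrite lee_fin|exact: insert0]. Qed.

Section exterior_linearity.
Variables (A B : set T) (mA : measurable A) (mB : measurable B).

Lemma exteriorD F G : measurable_functional F -> measurable_functional G ->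
  exterior (fun C => F C + G C) A B = exterior F A B + exterior G A B.
Proof.
move=> mF mG; rewrite /exterior -nneseriesD; first last.
- by move=> j *; exact: term0.
- by move=> j *; exact: term0.
apply: eq_eseriesr => j _; rewrite (insertD mu mE)// ge0_muleDr//.
by exact: insert0.
by exact: insert0.
Qed.

Lemma exteriorZ F (c : R) : (0 <= c)%R -> measurable_functional F ->
  exterior (fun C => c%:E * F C) A B = c%:E * exterior F A B.
Proof.
move=> c0 mF; rewrite /exterior -nneseriesZl; last first.
  by move=> j _; exact: term0.
by apply: eq_eseriesr => j _; rewrite (insertZ mu mE)// muleCA.
Qed.

Lemma exterior_le F G : measurable_functional F -> measurable_functional G ->
  (forall C, measurable C -> C `<=` A -> F C <= G C) ->
  exterior F A B <= exterior G A B.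
Proof.
move=> mF mG FG; apply: lee_nneseries => j *.
  exact: term0.
by rewrite lee_wpmul2l ?lee_fin//; exact: insert_le.
Qed.

(** [insert_peel] summed over [j]: a point of [A] may be singled out before or after the
    configuration in [B] is summed over. *)
Lemma integral_exterior F : measurable_functional F ->
  \int[mu]_(x in A) exterior F (avoid A x) (avoid B x) = exterior (peel F) A B.
Proof.
move=> mF; rewrite integral_nneseries//.
- apply: eq_eseriesr => j _; rewrite ge0_integralZl ?lee_fin//.
  + by rewrite (insert_peel mu mE symE).
  + by apply: measurable_funTS; exact: measurable_insert_avoid.
  + by move=> *; exact: insert0.
- move=> j; apply: measurable_funeM; apply: measurable_funTS.
  exact: measurable_insert_avoid.
- by move=> *; exact: term0.
Qed.

End exterior_linearity.

Lemma Q_le_expr n A (m : R) : measurable A -> mu A <= m%:E -> Q n A <= (m ^+ n)%:E.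
Proof.
elim: n A => [|n IH] A mA Am; first by rewrite expr0.
have m0 : (0 <= m)%R by rewrite -lee_fin (le_trans _ Am).
rewrite QS /peel; apply: (@le_trans _ _ (\int[mu]_(x in A) cst (m ^+ n)%:E x)).
  apply: ge0_le_integral => //.
  - by move=> *; exact: Q_ge0.
  - by apply: measurable_funTS; apply: measurable_functional_avoid => //; exact: measurable_Q.
  - move=> x _; apply: IH; first exact: mavoid.
    by apply: le_trans Am; apply: le_measure; rewrite ?inE//; [exact: mavoid|exact: avoid_sub].
rewrite integral_cst// exprSr EFinM lee_wpmul2l// lee_fin exprn_ge0//.
Qed.

Lemma Z_le_expR A (m : R) : measurable A -> mu A <= m%:E ->
  Z A <= (expR (l * m))%:E.
Proof.
move=> mA Am; apply: (@le_trans _ _ (\sum_(0 <= k <oo) (exp_coeff (l * m) k)%:E)).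
  rewrite ZE; apply: lee_nneseries => [k *|k _].
    by rewrite mule_ge0 ?lee_fin// Q_ge0.
  apply: (@le_trans _ _ ((coeff k)%:E * (m ^+ k)%:E)).
    by rewrite lee_wpmul2l ?lee_fin// Q_le_expr.
  by rewrite -EFinM lee_fin /exp_coeff/= exprMn mulrAC.
rewrite (_ : \sum_(0 <= k <oo) _ = (expR (l * m))%:E)//.
rewrite /expR -EFin_lim; last exact: is_cvg_series_exp_coeff.
by apply/congr_lim/funext => n /=; rewrite /series/= -sumEFin.
Qed.

(** Whatever the configuration in [B], the part of [A] left uncovered has measure at most [m], and
    [Z_le_expR] bounds its contribution. *)
Lemma Z_setU_le A B (m : R) : measurable A -> measurable B ->
  [disjoint A & B] -> mu A <= m%:E ->
  Z (A `|` B) <= (expR (l * m))%:E * Z B.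
Proof.
move=> mA mB AB Am; rewrite Z_setU// -(exterior1 mu E l A).
rewrite -(exteriorZ mA mB (expR_ge0 _)); last exact: measurable_functional1.
apply: exterior_le => //.
move=> C mC CA; rewrite mule1; apply: Z_le_expR => //; apply: le_trans Am.
by apply: le_measure; rewrite ?inE.
Qed.

Lemma avoid_setIU A x : A = (A `&` xsection E x) `|` avoid A x.
Proof. exact/esym/setUIDK. Qed.

Lemma disjoint_avoid A x : [disjoint A `&` xsection E x & avoid A x].
Proof. by apply/disj_set2P/seteqP; split => // y [[_ ?] [_]]. Qed.

Let mIE A x : measurable A -> measurable (A `&` xsection E x).
Proof. by move=> mA; apply: measurableI => //; exact: measurable_xsection. Qed.
#[local] Hint Resolve mIE : core.

Lemma fin_num_Z A : measurable A -> mu A < +oo -> Z A \is a fin_num.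
Proof.
move=> mA Aoo; rewrite ge0_fin_numE//.
have Afin : mu A \is a fin_num by rewrite ge0_fin_numE.
by apply: le_lt_trans (Z_le_expR mA (m := fine (mu A)) _) (ltry _); rewrite fineK.
Qed.

Lemma fin_num_peel_Z A : measurable A -> mu A < +oo -> peel Z A \is a fin_num.
Proof.
move=> mA Aoo; rewrite ge0_fin_numE; last by apply: integral_ge0.
have Afin : mu A \is a fin_num by rewrite ge0_fin_numE.
apply: (@le_lt_trans _ _ (\int[mu]_(x in A) cst (expR (l * fine (mu A)))%:E x)).
  apply: ge0_le_integral => //.
    by apply: measurable_funTS; exact: measurable_functional_avoid.
  move=> x _; apply: Z_le_expR; first exact: mavoid.
  by rewrite fineK//; apply: le_measure; rewrite ?inE//; [exact: mavoid|exact: avoid_sub].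
by rewrite integral_cst// lte_mul_pinfty// lee_fin expR_ge0.
Qed.

(** [Z_setU_le] bounds Z of the remaining set below by exp (- l a) Z_A, where a is the measure
    removed; 1 - t <= exp (- t) then makes the loss linear in a, ready to be integrated over [x]. *)
Lemma Z_avoid_ge A x : measurable A -> mu A < +oo ->
  Z A <= Z (avoid A x) + (l%:E * Z A) * mu (A `&` xsection E x).
Proof.
move=> mA Aoo.
have IA : mu (A `&` xsection E x) <= mu A.
  by apply: le_measure; rewrite ?inE//; exact: mIE.
have Ifin : mu (A `&` xsection E x) \is a fin_num.
  by rewrite ge0_fin_numE// (le_lt_trans IA).
have Zfin := fin_num_Z mA Aoo.
have Wfin : Z (avoid A x) \is a fin_num.
  apply: fin_num_Z; first exact: mavoid.
  by apply: le_lt_trans Aoo; apply: le_measure; rewrite ?inE//; [exact: mavoid|exact: avoid_sub].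
have := Z_setU_le (mIE x mA) (mavoid x mA) (disjoint_avoid A x) (m := fine (mu (A `&` xsection E x))).
rewrite fineK// => /(_ (lexx _)); rewrite -avoid_setIU.
move: (Z0 A); rewrite -(fineK Zfin) -(fineK Wfin) -(fineK Ifin) -!EFinM -EFinD !lee_fin/=.
set z := fine (Z A); set w := fine (Z _); set a := fine (mu _) => z0 zw.
have : (z * expR (- (l * a)) <= w)%R.
  by rewrite expRN ler_pdivrMr ?expR_gt0// (mulrC w).
have : (z * (1 - l * a) <= z * expR (- (l * a)))%R by rewrite ler_wpM2l// expR_ge1Dx.
by lra.
Qed.

(** The integral of [Z_avoid_ge] over [A], with the loss kept on the right-hand side so that nothing
    is subtracted in the extended reals. *)
Lemma peel_Z_ge A (K : R) : measurable A -> mu A < +oo ->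
  \int[mu]_(x in A) mu (A `&` xsection E x) <= K%:E * mu A ->
  Z A * mu A <= peel Z A + (l * K)%:E * (Z A * mu A).
Proof.
move=> mA Aoo KA; have Zfin := fin_num_Z mA Aoo.
have mI : measurable_fun setT (fun x => mu (A `&` xsection E x)).
  pose U := (setT `*` A) `&` E.
  have mU : measurable U by apply: measurableI => //; exact: measurableX.
  apply: eq_measurable_fun (measurable_fun_xsection mu mU) => x _ /=.
  by rewrite !xsectionE /U preimage_setI; congr (mu (_ `&` _)); apply/seteqP; split=> y //= [].
rewrite -[leLHS]integral_cst//.
apply: (@le_trans _ _ (\int[mu]_(x in A)
    (Z (avoid A x) + (l%:E * Z A) * mu (A `&` xsection E x)))).
  apply: ge0_le_integral => //; last by move=> x _; exact: Z_avoid_ge.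
    by move=> x _; exact: Z0.
  apply: emeasurable_funD; first by apply: measurable_funTS; exact: measurable_functional_avoid.
  by apply: measurable_funeM; exact: measurable_funTS.
have lZ : 0 <= l%:E * Z A by rewrite mule_ge0.
rewrite ge0_integralD//; last 3 first.
- by apply: measurable_funTS; exact: measurable_functional_avoid.
- by move=> x _; rewrite mule_ge0.
- by apply: measurable_funeM; exact: measurable_funTS.
rewrite leeD2l// ge0_integralZl//; last exact: measurable_funTS.
apply: (@le_trans _ _ (l%:E * Z A * (K%:E * mu A))); first by rewrite lee_wpmul2l.
by rewrite EFinM -!muleA lee_wpmul2l// muleCA.
Qed.

(* The tangent line of [z log z], with [a] in the place of [log z]. *)
Lemma mul_le_tangent (a c z : R) : (0 <= z)%R -> (z <= expR a)%R ->
  (c * z <= a * z + expR (c - 1))%R.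
Proof.
move=> z0 za; have [ca|ac] := lerP c a.
  by rewrite (le_trans (ler_wpM2r z0 ca))// lerDl expR_ge0.
rewrite -lerBlDl -mulrBl; apply: (@le_trans _ _ ((c - a) * expR a)%R).
  by rewrite ler_wpM2l// subr_ge0 ltW.
rewrite (_ : c - 1 = (c - a - 1) + a)%R; last by ring.
by rewrite expRD ler_wpM2r ?expR_ge0// (le_trans _ (expR_ge1Dx _))//; lra.
Qed.

(** The tangent line is used with [a = l * mu A]. It replaces the product of Z_A and the measure of
    [A] in [peel_Z_ge] by terms linear in [Z A] and 1; linearity is what lets the inequality pass
    through [exterior]. *)
Lemma peel_Z_tangent A (K c : R) : measurable A -> mu A < +oo ->
  (l * K <= 1)%R ->
  \int[mu]_(x in A) mu (A `&` xsection E x) <= K%:E * mu A ->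
  ((1 - l * K) * c)%:E * Z A <=
  l%:E * peel Z A + ((1 - l * K) * expR (c - 1))%:E.
Proof.
move=> mA Aoo lK /(peel_Z_ge mA Aoo).
have Afin : mu A \is a fin_num by rewrite ge0_fin_numE.
have := Z_le_expR mA (m := fine (mu A)).
rewrite (fineK Afin) => /(_ (lexx _)); have := Z0 A.
have : 0 <= peel Z A by exact: (measurable_peel mu mE mZ).1.
rewrite -(fineK (fin_num_Z mA Aoo)) -(fineK Afin).
rewrite -(fineK (fin_num_peel_Z mA Aoo)) -!EFinM -!EFinD !lee_fin/=.
set z := fine (Z A); set a := fine (mu A); set p := fine (peel _ _) => _ z0 za zap.
have lp : (l * (z * a) * (1 - l * K) <= l * p)%R.
  by rewrite -mulrA ler_wpM2l//; lra.
rewrite mulrAC; apply: le_trans (lerD lp (lexx _)).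
have := ler_wpM2r (_ : 0 <= 1 - l * K)%R (mul_le_tangent c z0 za).
by rewrite subr_ge0 => /(_ lK); lra.
Qed.

End fugacity_bounds.

(** * Summing over the centre *)

Section occupancy.
Local Open Scope ereal_scope.
Context d (T : measurableType d) (R : realType).
Variable mu : {sigma_finite_measure set T -> \bar R}.
Variable E : set (T * T).
Hypothesis mE : measurable E.
Hypothesis symE : forall x y, E (x, y) -> E (y, x).
Variable l : R.
Hypothesis l0 : (0 <= l)%R.
Local Notation avoid := (avoid E).
Local Notation peel := (peel mu E).
Local Notation Q := (packing_integral mu E).
Local Notation coeff := (coeff l).
Local Notation exterior := (exterior mu E l).
Local Notation Z := (gas_partition mu E l).

Variables (S : set T) (K c : R).
Hypotheses (mS : measurable S) (Soo : mu S < +oo).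
Hypotheses (lK : (l * K <= 1)%R) (c0 : (0 <= c)%R).
Hypothesis E_local : forall v A, measurable A -> A `<=` S `&` xsection E v ->
  \int[mu]_(x in A) mu (A `&` xsection E x) <= K%:E * mu A.

Let mZ : measurable_functional Z. Proof. exact: measurable_Z. Qed.

Lemma occupancy_local v :
  ((1 - l * K) * c)%:E * Z S <=
  l%:E * (\int[mu]_(x in S `&` xsection E v) Z (avoid S x))
  + ((1 - l * K) * expR (c - 1))%:E * Z (avoid S v).
Proof.
have lK' : (0 <= 1 - l * K)%R by rewrite subr_ge0.
set A := S `&` xsection E v; set B := avoid S v.
have mA : measurable A by apply: measurableI => //; exact: measurable_xsection.
have mB : measurable B by exact: measurable_avoid.
have AB : [disjoint A & B] by exact: disjoint_avoid.
have SAB : S = A `|` B by exact: avoid_setIU.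
have m1 := @measurable_functional1 _ T R.
have mP : measurable_functional (peel Z) by exact: measurable_peel.
(* All three terms become sums over the configurations in [B]: of [Z] on the left, of [peel Z] for
   the integral, and of 1 for [Z B]. *)
rewrite [in X in X <= _]SAB (Z_setU mu mE symE l0 mA mB AB).
rewrite (eq_integral (fun x => exterior Z (avoid A x) (avoid B x))); last first.
  move=> x _; rewrite SAB avoidU Z_setU//; try exact: measurable_avoid.
  apply/disj_set2P/seteqP; split => // y [[Ay _] [By _]].
  by move/disj_set2P : AB => <-.
rewrite (integral_exterior mu mE symE l0 mA mB mZ) -(exterior1 mu E l A B).
have k1 : (0 <= (1 - l * K) * c)%R by exact: mulr_ge0.
have k2 : (0 <= (1 - l * K) * expR (c - 1))%R by rewrite mulr_ge0// expR_ge0.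
rewrite -!exteriorZ// -exteriorD//; try exact: measurable_functionalZ.
apply: exterior_le => //; first exact: measurable_functionalZ.
  split=> [C|d' O W mW]; first by rewrite adde_ge0// mule_ge0//; exact: mP.1.
  apply: emeasurable_funD; last exact: measurable_cst.
  by apply: measurable_funeM; exact: mP.2.
(* Every uncovered part [C] still lies in the ball about [v], so [E_local] applies to it. *)
move=> C mC CA; rewrite mule1; apply: peel_Z_tangent => //.
  apply: le_lt_trans Soo; apply: le_measure; rewrite ?inE//.
  by move=> x /CA[].
exact: (@E_local v).
Qed.

(** [occupancy_local] integrated over [v] in [S]. In the double integral each [x] is weighted by the
    measure of the centres [v] whose ball contains it, which is at most [V]. *)
Lemma occupancy (V : R) : (forall x, S x -> mu (xsection E x) <= V%:E) ->
  ((1 - l * K) * c)%:E * (mu S * Z S) <=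
  (l * V + (1 - l * K) * expR (c - 1))%:E * peel Z S.
Proof.
move=> EV; have lK' : (0 <= 1 - l * K)%R by rewrite subr_ge0.
(* A point of [S] is what shows that [V] is nonnegative. *)
have [S0|/set0P[x0 Sx0]] := eqVneq S set0; first by rewrite S0 measure0 mul0e mule0 /peel integral_set0 mule0.
have V0 : (0 <= V)%R by rewrite -lee_fin (le_trans _ (EV _ Sx0)).
have k2 : (0 <= (1 - l * K) * expR (c - 1))%R by rewrite mulr_ge0// expR_ge0.
have Z0 A : 0 <= Z A by exact: mZ.1.
have mZS : measurable_fun setT (fun x => Z (avoid S x)).
  exact: measurable_functional_avoid.
pose U := (S `*` S) `&` E.
have mU : measurable U by apply: measurableI => //; exact: measurableX.
have UE v : S v -> xsection U v = S `&` xsection E v.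
  by move=> Sv; rewrite !xsectionE; apply/seteqP; split => x /= => [[[]]|[]].
have mG : measurable_fun setT (fun p : T * T => Z (avoid S p.2)).
  exact: (measurableT_comp mZS measurable_snd).
have mI : measurable_fun setT (fun v => \int[mu]_(x in xsection U v) Z (avoid S x)).
  exact: (measurable_integral_section mu mU mG).
have I0 v : 0 <= \int[mu]_(x in xsection U v) Z (avoid S x) by exact: integral_ge0.
rewrite (muleC (mu S)) muleA -integral_cst//.
apply: (@le_trans _ _ (\int[mu]_(v in S)
    (l%:E * (\int[mu]_(x in xsection U v) Z (avoid S x))
     + ((1 - l * K) * expR (c - 1))%:E * Z (avoid S v)))).
  apply: ge0_le_integral => //.
  - by move=> v _; rewrite /= mule_ge0// lee_fin mulr_ge0.
  - apply: measurable_funTS; apply: emeasurable_funD; exact: measurable_funeM.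
  - by move=> v Sv; rewrite UE//; exact: occupancy_local.
rewrite ge0_integralD//; last 4 first.
- by move=> v _; rewrite mule_ge0.
- by apply: measurable_funTS; exact: measurable_funeM.
- by move=> v _; rewrite mule_ge0.
- by apply: measurable_funTS; exact: measurable_funeM.
rewrite !ge0_integralZl//; try by apply: measurable_funTS.
rewrite EFinD ge0_muleDl ?lee_fin ?mulr_ge0// leeD2r// EFinM -muleA lee_wpmul2l//.
(* After the exchange the inner integrand no longer depends on [v], and only the measure of the set
   of centres remains. *)
rewrite (@fubini_section _ _ _ _ _ mu mu U (fun p => Z (avoid S p.2)) mU mG _ S S)//; last first.
  by move=> x y [[]].
rewrite /peel -ge0_integralZl//; last exact: measurable_funTS.
rewrite [leLHS](eq_integral (fun y => Z (avoid S y) * mu (ysection U y))); last first.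
  by move=> y _; rewrite /= -[RHS]integral_cst//; exact: measurable_ysection.
apply: ge0_le_integral => //.
- by move=> *; rewrite mule_ge0.
- apply: measurable_funTS; apply: emeasurable_funM => //.
  exact: measurable_fun_ysection.
- by apply: measurable_funeM; exact: measurable_funTS.
move=> x Sx /=.
rewrite muleC lee_wpmul2r//; apply: le_trans (EV _ Sx).
apply: le_measure; rewrite ?inE.
- exact: measurable_ysection.
- exact: measurable_xsection.
- by rewrite ysectionE xsectionE => y [_ /symE].
Qed.

(* Both sides are [l Z'(l)], the unnormalised expected number of points. *)
Lemma peel_series : \sum_(0 <= n <oo) (n%:R * coeff n)%:E * Q n S = l%:E * peel Z S.
Proof.
have mQ n : measurable_fun setT (fun x => Q n (avoid S x)).
  by apply: (measurable_functional_avoid mu mE) => //; exact: measurable_Q.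
rewrite /peel integral_nneseries//; last 2 first.
- move=> n; apply: measurable_funeM; apply: measurable_funTS.
  exact: mQ.
- by move=> *; rewrite mule_ge0 ?Q_ge0// lee_fin coeff_ge0.
rewrite -nneseriesZl; last first.
  move=> n _; apply: integral_ge0 => *.
  by rewrite mule_ge0 ?Q_ge0// lee_fin coeff_ge0.
(* The term n = 0 vanishes; after the shift, (n+1) [coeff] (n+1) = l [coeff] n. *)
rewrite nneseries_recl//; last first.
  by move=> n _; rewrite mule_ge0 ?Q_ge0// lee_fin mulr_ge0// coeff_ge0.
rewrite mul0r mul0e add0e -nneseries_addn; last first.
  by move=> n; rewrite mule_ge0 ?Q_ge0// lee_fin mulr_ge0// coeff_ge0.
apply: eq_eseriesr => n _; rewrite ge0_integralZl//; last 3 first.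
- by apply: measurable_funTS; exact: mQ.
- by move=> *; exact: Q_ge0.
- by rewrite lee_fin coeff_ge0.
rewrite addn1 QS muleA -EFinM; congr (_%:E * _).
rewrite /coeff factS natrM exprS; field.
by rewrite nat1r !pnatr_eq0 -lt0n fact_gt0.
Qed.

End occupancy.

(** * Counting close pairs from one of their two ends *)

Section half_neighbourhoods.
Local Open Scope ereal_scope.
Context d (T : measurableType d) (R : realType).
Variable mu : {sigma_finite_measure set T -> \bar R}.
Variables E L : set (T * T).
Hypotheses (mE : measurable E) (mL : measurable L).
Hypothesis symE : forall x y, E (x, y) -> E (y, x).
Hypothesis totL : forall x y, L (x, y) \/ L (y, x).

(** By totality of [L], each close pair of points of [A] is seen in the [L]-half of the
    neighbourhood of one of its ends. Counting from either end gives the same total, whence the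
    factor 2. *)
Lemma integral_neighbourhood_le (A : set T) (k : R) : measurable A ->
  (forall x, A x -> mu (A `&` (xsection E x `&` xsection L x)) <= k%:E) ->
  \int[mu]_(x in A) mu (A `&` xsection E x) <= (2 * k)%:E * mu A.
Proof.
move=> mA Ak; pose U := (A `*` A) `&` (E `&` L).
have mU : measurable U.
  by apply: measurableI; [exact: measurableX|exact: measurableI].
pose W := (A `*` A) `&` E.
have mW : measurable W by apply: measurableI => //; exact: measurableX.
have WE x : A x -> A `&` xsection E x = xsection W x.
  by move=> Ax; rewrite !xsectionE; apply/seteqP; split => y /= [] => [|[]].
have UE x : A x -> A `&` (xsection E x `&` xsection L x) = xsection U x.
  move=> Ax; rewrite !xsectionE; apply/seteqP; split => y /=.
    by move=> [? [? ?]].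
  by move=> [[? ?] [? ?]].
have mUx : measurable_fun setT (fun x => mu (xsection U x)).
  exact: measurable_fun_xsection.
have mUy : measurable_fun setT (fun x => mu (ysection U x)).
  exact: measurable_fun_ysection.
rewrite (eq_integral (fun x => mu (xsection W x))); last first.
  by move=> x /[!inE] Ax; rewrite WE.
have W_le x : mu (xsection W x) <= mu (xsection U x) + mu (ysection U x).
  apply: (@le_trans _ _ (mu (xsection U x `|` ysection U x))).
    apply: le_measure; rewrite ?inE.
    - exact: measurable_xsection.
    - by apply: measurableU; [exact: measurable_xsection|exact: measurable_ysection].
    - rewrite !xsectionE ysectionE => y /= [[Ax Ay] Exy].
      by have [?|?] := totL x y; [left|right; split => //; split => //; exact: symE].
  by apply: measureU2; [exact: measurable_xsection|exact: measurable_ysection].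
apply: (@le_trans _ _ (\int[mu]_(x in A) (mu (xsection U x) + mu (ysection U x)))).
  apply: ge0_le_integral => //.
  - by apply: measurable_funTS; exact: measurable_fun_xsection.
  - by apply: measurable_funTS; exact: emeasurable_funD.
rewrite ge0_integralD//; try exact: measurable_funTS.
(* Both integrals are the product measure of [U], by Tonelli with integrand 1. *)
have -> : \int[mu]_(x in A) mu (ysection U x) = \int[mu]_(x in A) mu (xsection U x).
  have m1 : measurable_fun setT (cst 1 : T * T -> \bar R) by [].
  have := fubini_section mu mu mU m1 (fun=> lee01) (A := A) (B := A).
  move=> H; transitivity (\int[mu]_(y in A) \int[mu]_(x in ysection U y) cst 1 x).
    by apply: eq_integral => y _; rewrite integral_cst ?mul1e//; exact: measurable_ysection.
  rewrite -[LHS]H; last by move=> x y [[]].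
  by apply: eq_integral => x _; rewrite integral_cst ?mul1e//; exact: measurable_xsection.
have Uk : \int[mu]_(x in A) mu (xsection U x) <= k%:E * mu A.
  rewrite -integral_cst//; have [->|/set0P[a Aa]] := eqVneq A set0.
    by rewrite !integral_set0.
  have k0 : 0 <= k%:E by apply: le_trans (Ak _ Aa).
  apply: ge0_le_integral => //; first exact: measurable_funTS.
  by move=> x Ax; rewrite -UE//; exact: Ak.
apply: le_trans (leeD Uk Uk) _.
by rewrite -mule2n -mule_natl EFinM muleA.
Qed.

End half_neighbourhoods.

(** * Volumes of balls *)

Section scaling.
Local Open Scope ereal_scope.

Lemma product_measure_scale d1 d2 (T1 : measurableType d1) (T2 : measurableType d2)
  (R : realType) (m1 : {sigma_finite_measure set T1 -> \bar R})
  (m2 : {sigma_finite_measure set T2 -> \bar R})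
  (f : T1 -> T1) (g : T2 -> T2) (a b : {nonneg R}) (X : set (T1 * T2)) :
  measurable_fun setT f -> measurable_fun setT g ->
  (forall A, measurable A -> m1 (f @^-1` A) = a%:num%:E * m1 A) ->
  (forall A, measurable A -> m2 (g @^-1` A) = b%:num%:E * m2 A) ->
  measurable X ->
  (m1 \x m2) ((fun p => (f p.1, g p.2)) @^-1` X) =
  (a%:num * b%:num)%:E * (m1 \x m2) X.
Proof.
move=> mf mg m1f m2g mX; rewrite /product_measure1/=.
have mX2 : measurable_fun setT (fun x => m2 (xsection X x)).
  exact: measurable_fun_xsection.
transitivity (\int[m1]_x (b%:num%:E * m2 (xsection X (f x)))).
  apply: eq_integral => x _; rewrite /= -m2g; last exact: measurable_xsection.
  by congr (m2 _); rewrite !xsectionE.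
rewrite ge0_integralZl//; last exact: measurableT_comp mX2 mf.
rewrite mulrC EFinM -muleA; congr (_ * _).
(* Change of variables: the pushforward of [m1] by [f] is [a] times [m1]. *)
have := ge0_integral_pushforward mf m1 measurableT mX2 (fun x _ => measure_ge0 _ _).
rewrite preimage_setT => <-.
rewrite -(ge0_integral_mscale m1 measurableT a mX2)//.
apply: eq_measure_integral => A mA _.
by rewrite /= /pushforward /mscale/=; exact: m1f.
Qed.

Context d (T : measurableType d) (R : realType).
Variable mu : {sigma_finite_measure set T -> \bar R}.

Definition tuple_map n (f : 'I_n -> T -> T) (t : n.-tuple T) : n.-tuple T :=
  [tuple f i (tnth t i) | i < n].

Lemma tuple_measure_scale n (f : 'I_n -> T -> T) (a : {nonneg R}) X :
  (forall i, measurable_fun setT (f i)) ->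
  (forall i A, measurable A -> mu (f i @^-1` A) = a%:num%:E * mu A) ->
  measurable X ->
  tuple_measure mu n (tuple_map f @^-1` X) = (a%:num ^+ n)%:E * tuple_measure mu n X.
Proof.
elim: n f X => [|n IH] f X mf muf mX.
  rewrite expr0 mul1e (_ : _ @^-1` X = X)//; apply/funext => t.
  by rewrite /preimage/= (_ : tuple_map f t = t)//; apply: eq_from_tnth => -[].
pose g i := f (lift ord0 i).
have mg : measurable_fun setT (tuple_map g).
  apply/measurable_fun_tnthP => i.
  rewrite (_ : _ \o _ = g i \o (fun t => tnth t i)).
    by apply: measurableT_comp; [exact: mf|exact: measurable_tnth].
  by apply/funext => t /=; rewrite tnth_mktuple.
have mY : measurable (@cons_pair _ T n @^-1` X).
  by rewrite -[X in measurable X]setTI; exact: measurable_cons_pair.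
have an0 : (0 <= a%:num ^+ n)%R by exact: exprn_ge0.
have := @product_measure_scale _ _ _ _ _ mu (tuple_measure mu n) (f ord0) (tuple_map g) a (NngNum an0)
  _ (mf ord0) mg (muf ord0) _ mY.
rewrite exprS /= => <-; last by move=> A mA; exact: (IH g A (fun i => mf _) (fun i => muf _) mA).
rewrite /cons_measure /pushforward; congr (product_measure1 _ _ _).
apply/seteqP; split => -[x t] /=; rewrite (_ : tuple_map f _ = cons_pair (f ord0 x, tuple_map g t))//.
- apply: eq_from_tnth => i; rewrite tnth_mktuple.
  case: (unliftP ord0 i) => [j|] ->; first by rewrite !tnthS tnth_mktuple.
  by rewrite !tnth0.
- apply: eq_from_tnth => i; rewrite tnth_mktuple.
  case: (unliftP ord0 i) => [j|] ->; first by rewrite !tnthS tnth_mktuple.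
  by rewrite !tnth0.
Qed.

End scaling.

(** The pushforward by the affine map, divided by [t], agrees with Lebesgue measure on half-open
    intervals, hence everywhere by uniqueness. *)
Lemma lebesgue_measure_affine (R : realType) (x t : R) (A : set (measurableTypeR R)) :
  0 < t -> measurable A ->
  lebesgue_measure ((fun y => (y - x) / t) @^-1` A : set (measurableTypeR R)) =
  (t%:E * lebesgue_measure A)%E.
Proof.
move=> t0 mA; pose f (y : measurableTypeR R) : measurableTypeR R := (y - x) / t.
have mf : measurable_fun setT f.
  by apply: measurable_funM => //; exact: measurable_funB.
have ti0 : 0 <= t^-1 by rewrite invr_ge0 ltW.
pose m : {measure set (measurableTypeR R) -> \bar R} := mscale (NngNum ti0)
  (measure_function_pushforward__canonical__measure_function_Measure
    (@lebesgue_measure R) mf).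
have -> : lebesgue_measure A = m A.
  apply: lebesgue_measure_unique => //= _ [[a b]] _ <-.
  rewrite /m /= /mscale /= /pushforward.
  rewrite (_ : f @^-1` _ = `]x + t * a, x + t * b]%classic); last first.
    by apply/seteqP; split => y /=; rewrite !in_itv/= /f ltr_pdivlMr// ler_pdivrMr//;
      rewrite (mulrC a) (mulrC b) ltrBrDl lerBlDl.
  rewrite !lebesgue_measure_itv/= !lte_fin ltrD2l ltr_pM2l//.
  case: ifP => _; last by rewrite mule0.
  by rewrite -!EFinB -EFinM; congr (_%:E); field; rewrite gt_eqF.
by rewrite /m /= /mscale /= muleA -EFinM divff ?mul1e// gt_eqF.

Qed.

Section balls.
Context (R : realType) (d : nat).
Local Notation space := (Rd R d).
Local Notation coord := (@Defs.coord R d).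
Local Notation borel := (measurable : set (set (d.-tuple (measurableTypeR R)))).
Implicit Types (x y : space) (r s t : R).

Lemma dist_sym x y : dist x y = dist y x.
Proof. by rewrite /dist; under eq_bigr do rewrite -opprB sqrrN. Qed.

Lemma sqr_dist x y : dist x y ^+ 2 = \sum_(i < d) (coord x i - coord y i) ^+ 2.
Proof. by rewrite sqr_sqrtr// sumr_ge0// => i _; exact: sqr_ge0. Qed.

Lemma borel_closed_eball x r : borel (closed_eball x r).
Proof.
have m : measurable_fun setT (fun y : d.-tuple (measurableTypeR R) => dist x y).
  apply: (@measurableT_comp _ _ _ _ _ _ (@Num.sqrt R)).
    by apply: continuous_measurable_fun; exact: sqrt_continuous.
  apply: measurable_sum => i; apply: measurable_funX; apply: measurable_funB => //.
  exact: measurable_tnth.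
rewrite (_ : closed_eball x r = (fun y => dist x y) @^-1` `]-oo, r]); last first.
  by apply/seteqP; split => y; rewrite /closed_eball /= in_itv.
by rewrite -[X in measurable X]setTI; apply: m => //; exact: measurable_itv.
Qed.

Lemma measurable_closed_eball x r : measurable (closed_eball x r).
Proof. by apply: caratheodory_measurable_mu_ext; exact: borel_closed_eball. Qed.

Lemma vol_closed_ebally x r : (vol (closed_eball x r) < +oo)%E.
Proof.
apply: vol_ebounded; first exact: measurable_closed_eball.
(* A crude diameter: two points of the ball differ by at most 2 r in each coordinate, so only the
   triangle inequality on the line is used. *)
exists (Num.sqrt (d%:R * (2 * r) ^+ 2)) => y z xy xz.
rewrite ler_wsqrtr// -[d in d%:R]card_ord -sum1_card natr_sum mulr_suml.
apply: ler_sum => i _; rewrite mul1r.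
have hy := le_trans (dist_coord x y i) xy.
have hz := le_trans (dist_coord x z i) xz.
rewrite -[leLHS]real_normK ?num_real// lerXn2r ?nnegrE//.
  by have := le_trans (normr_ge0 _) hy; lra.
rewrite (_ : _ - _ = (coord x i - coord z i) - (coord x i - coord y i)); last by ring.
by apply: le_trans (ler_normB _ _) _; lra.
Qed.

Lemma vol_closed_eball_scale x s t : 0 < s ->
  vol (closed_eball x (s * t)) = ((s ^+ d)%:E * vol (closed_eball (@origin R d) t))%E.
Proof.
move=> s0; rewrite !vol_borel; try exact: borel_closed_eball.
pose f (i : 'I_d) (y : measurableTypeR R) : measurableTypeR R := (y - coord x i) / s.
have mf i : measurable_fun setT (f i).
  by apply: measurable_funM => //; exact: measurable_funB.
have s0' := ltW s0.
have := @tuple_measure_scale _ _ R (@lebesgue_measure R) d f (NngNum s0')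
  (closed_eball (@origin R d) t) mf.
rewrite /borel_vol => <- //; last 2 first.
- by move=> i A mA; exact: lebesgue_measure_affine.
- exact: borel_closed_eball.
congr (_ _); apply/seteqP.
have E y : dist (@origin R d) (tuple_map f y) = dist x y / s.
  rewrite /dist -[s in RHS](gtr0_norm s0) -sqrtr_sqr -sqrtrV ?sqr_ge0// -sqrtrM; last first.
    by rewrite sumr_ge0// => i _; exact: sqr_ge0.
  congr (Num.sqrt _); rewrite mulr_suml; apply: eq_bigr => i _.
  rewrite /Defs.coord tnth_mktuple (tnth_nth 0)/= nth_nseq ltn_ord /f.
  by rewrite sub0r sqrrN exprMn exprVn -[in RHS]opprB sqrrN.
by split => y; rewrite /closed_eball /= E ler_pdivrMr// mulrC.
Qed.

Hypothesis d0 : (0 < d)%N.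

Lemma vol_closed_eball_gt0 : (0 < vol (closed_eball (@origin R d) 1))%E.
Proof.
(* In this cube each squared coordinate is at most 1/d^2 <= 1/d, so it lies in the ball of radius
   1. *)
pose A (i : 'I_d) : set (measurableTypeR R) := `[- d%:R^-1, d%:R^-1]%classic.
have d0' : (0 < d%:R^-1 :> R) by rewrite invr_gt0 ltr0n.
have mA i : measurable (A i) by exact: measurable_itv.
have mB : borel (box A) by exact: measurable_box.
apply: (@lt_le_trans _ _ (vol (box A : set space))).
  rewrite vol_borel// [X in (_ < X)%E](tuple_measure_box _ mA).
  have muA i : lebesgue_measure (A i) = (d%:R^-1 - - d%:R^-1)%:E.
    by rewrite /A lebesgue_measure_itv/= lte_fin gtrN// -EFinB.
  rewrite (eq_bigr _ (fun i _ => muA i)) prodEFin lte_fin prodr_gt0// => i _.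
  by lra.
apply: le_measure; rewrite ?inE.
- exact: caratheodory_measurable_mu_ext.
- exact: measurable_closed_eball.
- move=> y yA; rewrite /closed_eball/= /dist -[leRHS]sqrtr1 ler_wsqrtr//.
  apply: (@le_trans _ _ (\sum_(i < d) d%:R^-1)); last first.
    by rewrite sumr_const card_ord -[_ *+ d]mulr_natr mulVf// pnatr_eq0 -lt0n.
  apply: ler_sum => i _; have := yA i; rewrite /A /= in_itv/= => /andP[h1 h2].
  rewrite /Defs.coord (tnth_nth 0)/= nth_nseq ltn_ord sub0r sqrrN -/(coord y i).
  apply: (@le_trans _ _ (d%:R^-1 ^+ 2)).
    by rewrite -[leLHS]real_normK ?num_real// lerXn2r ?nnegrE ?ler_norml ?(ltW d0') ?h1.
  by rewrite expr2 ler_piMl ?(ltW d0')// invf_le1 ?ltr0n// ler1n.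
Qed.

(** Excludes the default value of [xget]: if v is the volume of the ball of radius 1, the radius
    v^(-1/d) gives volume 1. *)
Lemma vol_unit_ball : vol (closed_eball (@origin R d) (unit_vol_radius R d)) = 1%E.
Proof.
rewrite /unit_vol_radius; case: xgetP => [r _ []//|].
set v := vol (closed_eball (@origin R d) 1).
have v0 : (0 < v)%E := vol_closed_eball_gt0.
have vfin : v \is a fin_num by rewrite ge0_fin_numE ?ltW// vol_closed_ebally.
have w0 : 0 < fine v by rewrite fine_gt0// v0 ltey_eq vfin.
pose s := fine v `^ (- d%:R^-1).
have s0 : 0 < s by exact: powR_gt0.
move=> /(_ s) []; split; first exact: ltW.
rewrite -[s]mulr1 vol_closed_eball_scale// -/v -(fineK vfin) -EFinM.
rewrite -powR_mulrn ?ltW// /s -powRrM mulNr mulVf ?pnatr_eq0 -?lt0n//.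
by rewrite powRN powRr1 ?ltW// mulVf// gt_eqF.
Qed.

Lemma vol_ball x s : 0 < s -> vol (closed_eball x (s * unit_vol_radius R d)) = (s ^+ d)%:E.
Proof. by move=> s0; rewrite vol_closed_eball_scale// vol_unit_ball mule1. Qed.

Local Notation rd := (unit_vol_radius R d).

Definition overlap : set (space * space) := [set p | dist p.1 p.2 <= 2 * rd].

Lemma overlap_sym x y : overlap (x, y) -> overlap (y, x).
Proof. by rewrite /overlap/= dist_sym. Qed.

Lemma measurable_overlap : measurable overlap.
Proof.
rewrite -[overlap]setTI; apply: measurable_fun_le.
- exact: measurableT.
- by apply: measurable_dist; [exact: measurable_fst|exact: measurable_snd].
- exact: measurable_cst.
Qed.

Lemma xsection_overlap x : xsection overlap x = closed_eball x (2 * rd).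
Proof. by rewrite xsectionE. Qed.

(* The points of a ball of radius [2 r_d] about [v] that are no farther from [v]
   than [x] and within [2 r_d] of [x] lie in a ball of radius [sqrt 3 * r_d]
   centred at the midpoint of [v] and [x], by the parallelogram law. *)
Lemma half_neighbourhood_sub v x y :
  dist v x <= 2 * rd -> dist x y <= 2 * rd -> dist v y <= dist v x ->
  closed_eball ([tuple (coord v i + coord x i) / 2 | i < d] : space) (Num.sqrt 3 * rd) y.
Proof.
move=> vx xy vyx; rewrite /closed_eball/=.
have r0 := unit_vol_radius_ge0 R d.
have s0 : 0 <= Num.sqrt 3 * rd by rewrite mulr_ge0// sqrtr_ge0.
rewrite -ler_sqr ?nnegrE ?dist_ge0// sqr_dist exprMn sqr_sqrtr//.
have h1 : dist v x ^+ 2 <= (2 * rd) ^+ 2 by rewrite ler_sqr ?nnegrE ?dist_ge0// mulr_ge0.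
have h2 : dist x y ^+ 2 <= (2 * rd) ^+ 2 by rewrite ler_sqr ?nnegrE ?dist_ge0// mulr_ge0.
have h3 : dist v y ^+ 2 <= dist v x ^+ 2 by rewrite ler_sqr ?nnegrE ?dist_ge0.
(* With D = [dist v x], the right-hand side is at most D^2/4 + 2 r_d^2, which is at most 3 r_d^2
   since D <= 2 r_d. *)
rewrite (_ : \sum_(i < d) _ = dist v y ^+ 2 / 2 + dist x y ^+ 2 / 2 - dist v x ^+ 2 / 4).
  by move: h1 h2 h3; rewrite !exprMn; lra.
rewrite !sqr_dist !mulr_suml -!sumrN -!big_split/=; apply: eq_bigr => i _.
by rewrite {1}/Defs.coord tnth_mktuple; field.
Qed.

Lemma overlap_local v (A : set space) : measurable A -> A `<=` xsection overlap v ->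
  (\int[@vol R d]_(x in A) vol (A `&` xsection overlap x)
    <= (2 * Num.sqrt 3 ^+ d)%:E * vol A)%E.
Proof.
move=> mA Av.
(* [L] orders points by their distance to [v], so the [L]-half of a neighbourhood fits in a ball of
   volume [Num.sqrt 3 ^+ d]. *)
pose L : set (space * space) := [set p | dist v p.2 <= dist v p.1].
have mL : measurable L.
  rewrite -[L]setTI; apply: measurable_fun_le.
  - exact: measurableT.
  - by apply: measurable_dist; [exact: measurable_cst|exact: measurable_snd].
  - by apply: measurable_dist; [exact: measurable_cst|exact: measurable_fst].
apply: (integral_neighbourhood_le (L := L)) => //.
- exact: measurable_overlap.
- exact: overlap_sym.
- by move=> x y; rewrite /L/=; case: (leP (dist v y) (dist v x)) => [|/ltW]; [left|right].
- move=> x Ax; rewrite -(@vol_ball [tuple (coord v i + coord x i) / 2 | i < d]) ?sqrtr_gt0//.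
  apply: (le_measure (@vol R d)); rewrite ?inE.
  + apply: measurableI => //; apply: measurableI; apply: measurable_xsection => //.
    exact: measurable_overlap.
  + exact: measurable_closed_eball.
  + rewrite !xsectionE => y [Ay [/= xy vy]]; apply: half_neighbourhood_sub => //.
    by have := Av _ Ax; rewrite xsectionE.
Qed.

End balls.

(** * The hard sphere model *)

Section configuration_size.
Context (R : realType) (d : nat).
Local Notation space := (Rd R d).

Lemma dist_eq0 (x y : space) : dist x y <= 0 <-> x = y.
Proof.
split=> [xy|->].
  apply: eq_from_tnth => i; apply/eqP; rewrite -subr_eq0 -normr_le0.
  exact: le_trans (dist_coord x y i) xy.
rewrite /dist; under eq_bigr do rewrite subrr expr0n.
by rewrite big1// sqrtr0.
Qed.

(** An event on configurations is tested on all tuples, including those with repetitions, where the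
    number of points is the size after [undup]. The induction asks whether the head recurs in the
    tail; [P] is arbitrary so that it can be shifted by one. *)
Lemma measurable_size_undup n (P : set nat) :
  measurable [set t : n.-tuple space | P (size (undup t))].
Proof.
elim: n P => [|n IH] P.
  have [P0|P0] := pselect (P 0%N).
    rewrite (_ : mkset _ = setT)//; apply/seteqP; split => // t _ /=.
    by rewrite tuple0.
  rewrite (_ : mkset _ = set0)//; apply/seteqP; split => // t /=.
  by rewrite tuple0.
pose b := [set t : n.+1.-tuple space | thead t \in behead t].
have mb : measurable b.
  rewrite (_ : b = \big[setU/set0]_(i < n)
    [set t : n.+1.-tuple space | dist (tnth t ord0) (tnth t (lift ord0 i)) <= 0]).
    apply: bigsetU_measurable => i _; rewrite -[X in measurable X]setTI.
    apply: measurable_fun_le => //.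
    by apply: measurable_dist; exact: measurable_tnth.
  rewrite -bigcup_seq; apply/seteqP; split => t.
    rewrite /b /=; case: (tupleP t) => x s; rewrite theadE /= => /tnthP[i xi].
    exists i; first by rewrite /= mem_index_enum.
    by rewrite /= tnth0 tnthS; apply/dist_eq0.
  move=> [i _] /=; case: (tupleP t) => x s.
  rewrite tnth0 tnthS => /dist_eq0 xi; rewrite /b /= theadE xi.
  exact: mem_tnth.
pose g (t : n.+1.-tuple space) : n.-tuple space := [tuple of behead t].
have mg (A : set (n.-tuple space)) : measurable A -> measurable (g @^-1` A).
  by move=> mA; rewrite -[X in measurable X]setTI; exact: measurable_behead.
rewrite (_ : mkset _ = (b `&` g @^-1` [set t | P (size (undup t))]) `|`
    (~` b `&` g @^-1` [set t | P (size (undup t)).+1])).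
  apply: measurableU; apply: measurableI.
  - exact: mb.
  - exact: (mg _ (IH P)).
  - exact: measurableC.
  - exact: (mg _ (IH [set k | P k.+1])).
apply/seteqP; split => t; rewrite /b /g /=; case: (tupleP t) => x s /=; rewrite theadE.
  by case: ifPn => [xs|/negP xs] /= Ps; [left|right].
by case=> -[xs Ps]; [rewrite xs|move/negP/negPf : xs => ->].
Qed.

Lemma measurable_card (P : set nat) : measurable [set X : config space | P #|` X|].
Proof.
move=> k; rewrite (_ : _ @^-1` _ = [set t : k.-tuple space | P (size (undup t))]).
  exact: measurable_size_undup.
by apply/seteqP; split => t /=; rewrite /points card_fseq.
Qed.

End configuration_size.

Section hard_sphere_partition.
Context (R : realType) (d : nat).
Local Notation space := (Rd R d).
Local Notation volk := (tuple_measure (@vol R d)).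
Local Notation E := (@overlap R d).
Local Notation Q := (packing_integral (@vol R d) E).

Lemma hard_core_cons k (x : space) (t : k.-tuple space) :
  hard_core (cons_pair (x, t)) <->
  hard_core t /\ forall i, 2 * unit_vol_radius R d < dist x (tnth t i).
Proof.
split=> [h|[ht hx] i j].
  split=> [i j ij|i].
    by have := h (lift ord0 i) (lift ord0 j); rewrite !tnthS; apply; rewrite (inj_eq lift_inj).
  by have := h ord0 (lift ord0 i); rewrite tnthS tnth0; apply; exact: neq_lift.
case: (unliftP ord0 i) => [i'|] ->; case: (unliftP ord0 j) => [j'|] -> ij.
- by rewrite !tnthS; apply: ht; move: ij; rewrite (inj_eq lift_inj).
- by rewrite tnthS tnth0 dist_sym.
- by rewrite tnthS tnth0.
- by move: ij; rewrite eqxx.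
Qed.

(** Once the first point [x] is fixed in [S], the remaining points form an admissible tuple of [S]
    minus the ball about [x]; this is the recursion defining [Q]. *)
Lemma volk_admissible k (S : set space) : measurable S ->
  volk k (box (fun=> S) `&` @hard_core R d k) = Q k S.
Proof.
elim: k S => [|k IH] S mS.
  by rewrite /= diracE mem_set//; split=> -[].
rewrite /= /cons_measure /pushforward /product_measure1 /= QS /peel [RHS]integral_mkcond.
apply: eq_integral => x _; rewrite patchE; case: ifPn => [/[!inE] Sx|/negP].
  rewrite /= -IH; last exact: (measurable_avoid (@measurable_overlap R d)).
  congr (volk k _); rewrite /avoid !xsectionE; apply/seteqP; split => t /=.
    move=> [tS /hard_core_cons[ht hx]]; split => // i; split.
      by have := tS (lift ord0 i); rewrite tnthS.
    by rewrite /overlap /= => /(lt_le_trans (hx i)); rewrite ltxx.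
  move=> [tS ht]; split.
    move=> i; case: (unliftP ord0 i) => [i'|] ->; last by rewrite tnth0.
    by rewrite tnthS; have [] := tS i'.
  apply/hard_core_cons; split => // i; rewrite ltNge; apply/negP.
  by have [] := tS i.
rewrite inE => Sx; rewrite /= (_ : xsection _ _ = set0) ?measure0//.
rewrite xsectionE; apply/seteqP; split => // t /= [tS _]; apply: Sx.
by have := tS ord0; rewrite tnth0.
Qed.

Variables (S : set space) (mS : measurable S) (bS : ebounded S).
Local Notation Z l := (gas_partition (@vol R d) E l S).

Lemma coeff_Q (l : R) k :
  ((l ^+ k)%:E * Zhat S k = (coeff l k)%:E * Q k S)%E.
Proof. by rewrite ZhatE// volk_admissible// muleA -EFinM. Qed.

Lemma partition_funE (l : R) : partition_fun S l = Z l.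
Proof. by apply: eq_eseriesr => k _; rewrite coeff_Q insert1E. Qed.

(** Splitting by the number of points gives the series of k times the k-point probabilities, which
    [peel_series] evaluates. *)
Lemma expectation_card (l : {posnum R}) :
  ('E_(hard_sphere mS l)[fun X => #|` X|%:R] =
   l%:num%:E * peel (@vol R d) E (gas_partition (@vol R d) E l%:num) S * (fine (Z l%:num))^-1%:E)%E.
Proof.
have mc : measurable_fun setT (fun X : config space => (#|` X|%:R : R)%:E).
  move=> _ Y mY; rewrite setTI.
  exact: (measurable_card [set k | Y (k%:R)%:E]).
rewrite unlock.
pose F k := [set X : config space | #|` X| = k].
have mF k : measurable (F k) by exact: (measurable_card [set k]).
have FT : setT = \bigcup_k F k.
  by apply/seteqP; split => // X _; exists #|` X|.
rewrite FT ge0_integral_bigcup//; last 2 first.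
- by rewrite -FT.
- by apply/trivIsetP => i j _ _ ij; apply/seteqP; split => // X [Xi Xj]; move: ij; rewrite -Xi -Xj eqxx.
transitivity (\sum_(0 <= k <oo) ((fine (Z l%:num))^-1%:E * ((k%:R * coeff l%:num k)%:E * Q k S)))%E.
  apply: eq_eseriesr => k _.
  rewrite (eq_integral (cst (k%:R)%:E)); last by move=> X; rewrite inE => <-.
  rewrite integral_cst//.
  rewrite (_ : (_ * _ = k%:R%:E * hard_sphere mS l (F k))%E)// hard_sphere_card//.
  rewrite coeff_Q partition_funE.
  by rewrite (EFinM k%:R) [RHS]muleC -!muleA.
rewrite nneseriesZl; last first.
  move=> k _; apply: mule_ge0; last exact: (Q_ge0 (@vol R d) (@measurable_overlap R d)).
  by rewrite lee_fin mulr_ge0// coeff_ge0.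
rewrite muleC peel_series//; exact: measurable_overlap.
Qed.

End hard_sphere_partition.

(** * Packing density *)

(* Tilting a weight towards larger [k] increases the mean of [k]: compare
   [(k - m) r^k] with [(k - m) r^K], where [K] is the first integer above [m]. *)
Lemma ratio_series_expr (R : realType) (u : nat -> \bar R) (m r : R) :
  (forall k, 0 <= u k)%E -> 0 <= m -> 1 <= r ->
  (\sum_(0 <= k <oo) k%:R%:E * u k)%E \is a fin_num ->
  (m%:E * \sum_(0 <= k <oo) u k <= \sum_(0 <= k <oo) k%:R%:E * u k)%E ->
  (m%:E * \sum_(0 <= k <oo) (r ^+ k)%:E * u k <=
   \sum_(0 <= k <oo) k%:R%:E * ((r ^+ k)%:E * u k))%E.
Proof.
move=> u0 m0 r1 fin mu; pose K := (Num.truncn m).+1.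
have r0 k : 0 <= r ^+ k by rewrite exprn_ge0// (le_trans _ r1).
have key k : m * r ^+ k + k%:R * r ^+ K <= k%:R * r ^+ k + m * r ^+ K.
  have [kK|Kk] := ltnP k K.
    have km : k%:R <= m.
      by rewrite (@le_trans _ _ (Num.truncn m)%:R) ?ler_nat// truncn_le.
    have : 0 <= (m - k%:R) * (r ^+ K - r ^+ k).
      by rewrite mulr_ge0// subr_ge0// ler_weXn2l// ltnW.
    by lra.
  have km : m <= k%:R by rewrite ltW// (lt_le_trans (truncnS_gt m))// ler_nat.
  have : 0 <= (k%:R - m) * (r ^+ k - r ^+ K).
    by rewrite mulr_ge0// subr_ge0// ler_weXn2l.
  by lra.
have s0 (f : nat -> R) k : 0 <= f k -> (0 <= (f k)%:E * u k)%E.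
  by move=> f0; rewrite mule_ge0 ?lee_fin.
(* The comparison [key] involves differences; a finite series is added to both sides so that only
   nonnegative terms are summed. *)
rewrite -(leeD2rE _ _ (x := ((r ^+ K)%:E * \sum_(0 <= k <oo) k%:R%:E * u k)%E)); last first.
  by rewrite fin_numM.
have e0 k : (0 <= k%:R%:E * u k)%E by rewrite mule_ge0 ?lee_fin.
have e1 k : (0 <= (r ^+ k)%:E * u k)%E by rewrite mule_ge0 ?lee_fin.
have e2 k : (0 <= k%:R%:E * ((r ^+ k)%:E * u k))%E by rewrite mule_ge0 ?lee_fin.
apply: (@le_trans _ _ (\sum_(0 <= k <oo) k%:R%:E * ((r ^+ k)%:E * u k) +
    (r ^+ K)%:E * (m%:E * \sum_(0 <= k <oo) u k))%E); last first.
  by rewrite leeD2l// lee_wpmul2l ?lee_fin.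
rewrite muleA -EFinM -!nneseriesZl// -!nneseriesD//; first last.
- by move=> k *; rewrite mule_ge0 ?lee_fin.
- by move=> k *; rewrite mule_ge0 ?lee_fin.
- by move=> k *; rewrite mule_ge0 ?lee_fin ?mulr_ge0.
apply: lee_nneseries => k *; first by rewrite adde_ge0// mule_ge0 ?lee_fin.
rewrite !muleA -!EFinM -!ge0_muleDl ?lee_fin ?mulr_ge0// lee_wpmul2r//.
by rewrite -!EFinD lee_fin (mulrC (r ^+ K)) (mulrC (r ^+ K) m).
Qed.

Section density.
Context (R : realType) (d : nat).
Local Notation space := (Rd R d).
Local Notation mu := (@vol R d).
Local Notation E := (@overlap R d).
Local Notation Z l := (gas_partition mu E l).
Variables (S : set space) (mS : measurable S) (bS : ebounded S).

Let mE : measurable E. Proof. exact: measurable_overlap. Qed.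
Let Soo : (vol S < +oo)%E. Proof. exact: vol_ebounded. Qed.

Lemma packing_densityE (l : {posnum R}) : packing_density mS l =
  l%:num * fine (peel mu E (Z l%:num) S) / fine (Z l%:num S) / fine (vol S).
Proof.
rewrite /packing_density expectation_card//.
have l0 : 0 <= l%:num by [].
have Pfin := fin_num_peel_Z mE l0 mS Soo.
by rewrite -(fineK Pfin) -!EFinM.
Qed.

(** Passing from [l] to [l'] multiplies the k-point weight by (l'/l)^k, a tilt towards larger k, so
    a lower bound [m] on the mean number of points persists. *)
Lemma peel_Z_mono (l l' m : R) : 0 < l -> l <= l' -> 0 <= m ->
  (m%:E * Z l S <= l%:E * peel mu E (Z l) S ->
  m%:E * Z l' S <= l'%:E * peel mu E (Z l') S)%E.
Proof.
move=> l0 ll' m0; have l0' : 0 <= l' by rewrite ltW// (lt_le_trans l0).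
rewrite -!(peel_series mu mE) ?(ltW l0)//.
have E1 (x : R) : (\sum_(0 <= n <oo) (n%:R * coeff x n)%:E * packing_integral mu E n S =
    \sum_(0 <= n <oo) n%:R%:E * ((coeff x n)%:E * packing_integral mu E n S))%E.
  by apply: eq_eseriesr => n _; rewrite EFinM muleA.
have fin : (\sum_(0 <= n <oo) (n%:R * coeff l n)%:E * packing_integral mu E n S)%E \is a fin_num.
  rewrite (peel_series mu mE) ?(ltW l0)// fin_numM//.
  exact: (fin_num_peel_Z mE (ltW l0) mS Soo).
move: fin; rewrite !E1 !ZE => fin.
have r1 : 1 <= l' / l by rewrite ler_pdivlMr// mul1r.
have u0 k : (0 <= (coeff l k)%:E * packing_integral mu E k S)%E.
  by apply: mule_ge0; [rewrite lee_fin coeff_ge0// ltW|exact: Q_ge0].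
move=> /(ratio_series_expr u0 m0 r1 fin).
have E2 k : (((l' / l) ^+ k)%:E * ((coeff l k)%:E * packing_integral mu E k S) =
    (coeff l' k)%:E * packing_integral mu E k S)%E.
  rewrite muleA -EFinM /coeff expr_div_n; congr (_%:E * _)%E.
  by field; rewrite pnatr_eq0 -lt0n fact_gt0 expf_neq0// gt_eqF.
rewrite (eq_eseriesr (fun k _ => E2 k)).
by rewrite [X in (_ <= X)%E -> _](eq_eseriesr (fun k _ => congr1 (mule k%:R%:E) (E2 k))).
Qed.

End density.

(** * The error term and elementary estimates *)

Section bound.
Variable R : realType.

Definition kappa : R := ln (2 / Num.sqrt 3).

Lemma sqrt3_gt0 : 0 < Num.sqrt 3 :> R. Proof. by rewrite sqrtr_gt0. Qed.

Lemma kappa_gt0 : 0 < kappa.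
Proof.
rewrite ln_gt0// ltr_pdivlMr ?sqrt3_gt0// mul1r.
by rewrite -ltr_sqr ?nnegrE ?sqrtr_ge0// sqr_sqrtr//; lra.
Qed.

(** With u = d^(-1/2), [kappa] (1 + error) is [kappa] - 4 u - 3 [kappa] u^2. The 4 u pays for a term
    2 log d in the exponent, and 3 u^2 comes from (1 - 2 u^2) / (1 + u^2) >= 1 - 3 u^2. *)
Definition density_error (d : nat) : R :=
  - (4 * Num.sqrt d%:R^-1 / kappa + 3 * d%:R^-1).

Lemma cvg_density_error : density_error n @[n --> \oo] --> (0 : R).
Proof.
have h : (fun n => n%:R^-1 : R) n @[n --> \oo] --> (0 : R).
  apply/gtr0_cvgV0; first by near=> n; rewrite ltr0n; near: n; exists 1%N.
  exact: cvgr_idn.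
have hs : Num.sqrt (n%:R^-1 : R) @[n --> \oo] --> (0 : R).
  rewrite -[in X in _ --> X](@sqrtr0 R).
  exact: (continuous_cvg _ (@sqrt_continuous R 0) h).
suff : density_error n @[n --> \oo] --> - (4 * 0 / kappa + 3 * 0).
  by rewrite !mulr0 mul0r addr0 oppr0.
apply: cvgN; apply: cvgD; last by apply: cvgM => //; exact: cvg_cst.
by apply: cvgM; [apply: cvgM => //; exact: cvg_cst|exact: cvg_cst].
Unshelve. all: end_near. Qed.

Lemma ln_le_sqrt (x : R) : 0 < x -> ln x <= 2 * Num.sqrt x.
Proof.
move=> x0; have s0 : 0 < Num.sqrt x by rewrite sqrtr_gt0.
rewrite -[in leLHS](sqr_sqrtr (ltW x0)) lnXn// -[ln _ *+ 2]mulr_natl ler_wpM2l//.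
have : -1 < Num.sqrt x - 1 by lra.
by move=> /le_ln1Dx; rewrite (_ : 1 + _ = Num.sqrt x); [lra|ring].
Qed.

(** A positive target forces u^2 < 1/3. This supplies the conditions [l * K <= 1] and [0 <= c] of
    [occupancy]. *)
Lemma density_slack (k u : R) : 0 < k -> 0 < u ->
  0 < k - 4 * u - 3 * k * u ^+ 2 -> 2 * u ^+ 2 <= 1 /\ 0 <= k - 4 * u.
Proof.
move=> k0 u0 g0; have t0 : 0 <= k * u ^+ 2 by rewrite mulr_ge0 ?sqr_ge0// ltW.
split; last by lra.
rewrite -(ler_pM2l k0); lra.
Qed.

(** Here [k] is [kappa], [u] is d^(-1/2), [n] is d, [t] is 2^d, [M] is the volume of S, [z] is Z_S
    and [p] is its [peel]. The factor 1 - 2 u^2 is 1 - l K, and l t u^2 is e^(c-1). *)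
Lemma density_arith (k u n t c l M z p : R) :
  0 < k -> 0 < u -> 0 < n -> 0 < t -> 0 <= l -> 0 <= M -> 0 <= z -> 0 <= p ->
  2 * u ^+ 2 <= 1 -> n * (k - 4 * u) <= c ->
  (1 - 2 * u ^+ 2) * c * (M * z) <=
    (l * t + (1 - 2 * u ^+ 2) * (l * t * u ^+ 2)) * p ->
  (k - 4 * u - 3 * k * u ^+ 2) * n / t * M * z <= l * p.
Proof.
move=> k0 u0 n0 t0 l0 M0 z0 p0 u21 kc occ; set g := k - _ - _.
have uu0 : 0 <= u ^+ 2 by exact: sqr_ge0.
set W := t * (l * p).
have W0 : 0 <= W by apply: mulr_ge0; [exact: ltW|exact: mulr_ge0].
have Mz0 : 0 <= M * z by exact: mulr_ge0.
have upper : (1 - 2 * u ^+ 2) * c * (M * z) <= (1 + u ^+ 2) * W.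
  apply: le_trans occ _.
  rewrite (_ : _ * p = (1 + (1 - 2 * u ^+ 2) * u ^+ 2) * W); last by rewrite /W; ring.
  rewrite ler_wpM2r// lerD2l -[leRHS]mul1r ler_wpM2r// lerBlDr lerDl.
  exact: mulr_ge0.
have lower : (1 + u ^+ 2) * (g * n * (M * z)) <= (1 - 2 * u ^+ 2) * c * (M * z).
  rewrite (mulrA (1 + u ^+ 2)) ler_wpM2r//.
  apply: (@le_trans _ _ ((1 - 2 * u ^+ 2) * (n * (k - 4 * u)))); last first.
    by rewrite ler_wpM2l// subr_ge0.
  rewrite -subr_ge0 (_ : _ - _ = n * (12 * u * u ^+ 2 + 3 * k * (u ^+ 2 * u ^+ 2))).
    by rewrite mulr_ge0 ?(ltW n0)// addr_ge0 ?mulr_ge0// ltW.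
  by rewrite /g; ring.
have gW : g * n * (M * z) <= W.
  rewrite -(@ler_pM2l _ (1 + u ^+ 2)); first exact: le_trans lower upper.
  by rewrite ltr_pwDl.
rewrite -(ler_pM2l t0) (_ : t * (g * n / t * M * z) = g * n * (M * z))//.
by field; rewrite gt_eqF.
Qed.

(** From log d <= 2 sqrt d, the loss 2 log d is at most 4 sqrt d = 4 d u with u = d^(-1/2). *)
Lemma exponent_ge (k : R) (d : nat) : (0 < d)%N ->
  d%:R * (k - 4 * Num.sqrt d%:R^-1) <= 1 + (d%:R * k - 2 * ln d%:R).
Proof.
move=> d0; have dR : 0 < d%:R :> R by rewrite ltr0n.
have := ln_le_sqrt dR.
have -> : Num.sqrt d%:R = d%:R * Num.sqrt d%:R^-1 :> R.
  rewrite -[X in X * _](ger0_norm (ltW dR)) -sqrtr_sqr -sqrtrM ?sqr_ge0//.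
  by rewrite expr2 mulfK// gt_eqF.
by lra.
Qed.

Lemma powR_sqrt3 (d : nat) : 3 `^ (- (d%:R / 2)) = (Num.sqrt 3 ^+ d)^-1 :> R.
Proof.
by rewrite powRN mulrC powRrM powR12_sqrt// powR_mulrn.
Qed.

Lemma expR_kappa (d : nat) : (0 < d)%N ->
  expR (d%:R * kappa - 2 * ln d%:R) = (2 / Num.sqrt 3) ^+ d / d%:R ^+ 2 :> R.
Proof.
move=> d0; have dR : 0 < d%:R :> R by rewrite ltr0n.
by rewrite expRD expRN !expRM_natl !lnK// posrE//.
Qed.

End bound.

Lemma packing_density_lower_bound (R : realType) (d : nat) (S : set (Rd R d))
  (mS : measurable S) (l : {posnum R}) :
  (0 < d)%N -> ebounded S -> (0 < vol S)%E -> (Num.sqrt 3 ^+ d)^-1 <= l%:num ->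
  (1 + density_error R d) * (kappa R * d%:R / 2 ^+ d) <= packing_density mS l.
Proof.
move=> d0 bS S0 ll.
have dR : 0 < d%:R :> R by rewrite ltr0n.
have k0 := kappa_gt0 R.
have mE := @measurable_overlap R d.
have Soo : (vol S < +oo)%E by exact: vol_ebounded.
have M0 : 0 < fine (vol S) by rewrite fine_gt0// S0.
have Zfin (x : R) : 0 <= x -> gas_partition (@vol R d) (@overlap R d) x S \is a fin_num.
  by move=> x0; exact: fin_num_Z.
have Z1 (x : R) : 0 <= x -> 1 <= fine (gas_partition (@vol R d) (@overlap R d) x S).
  by move=> x0; rewrite -lee_fin fineK ?Zfin//; exact: Z_ge1.
have Pfin (x : R) : 0 <= x -> peel (@vol R d) (@overlap R d) (gas_partition (@vol R d) (@overlap R d) x) S \is a fin_num.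
  by move=> x0; exact: fin_num_peel_Z.
have P0 (x : R) : 0 <= x -> 0 <= fine (peel (@vol R d) (@overlap R d) (gas_partition (@vol R d) (@overlap R d) x) S).
  move=> x0; apply: fine_ge0; apply: integral_ge0 => *.
  by apply: le_trans lee01 _; exact: Z_ge1.
have ln0 : 0 <= l%:num by [].
set u := Num.sqrt (d%:R^-1 : R).
have u0 : 0 < u by rewrite sqrtr_gt0 invr_gt0.
have u2 : u ^+ 2 = d%:R^-1 by rewrite sqr_sqrtr// invr_ge0 ltW.
have du2 : d%:R * u ^+ 2 = 1 by rewrite u2 divff// gt_eqF.
set g := kappa R - 4 * u - 3 * kappa R * u ^+ 2.
have -> : (1 + density_error R d) * (kappa R * d%:R / 2 ^+ d) = g * d%:R / 2 ^+ d.
  rewrite /density_error -/u -u2 /g; field.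
  by rewrite !gt_eqF// exprn_gt0.
(* In the dimensions where the claimed bound is nonpositive, it holds because a density is
   nonnegative. *)
have [g0|g0] := lerP g 0.
  apply: (@le_trans _ _ 0).
    by rewrite -mulrA mulr_le0_ge0// divr_ge0// ltW.
  rewrite packing_densityE// divr_ge0 ?(ltW M0)// divr_ge0 ?(le_trans ler01 (Z1 _ ln0))//.
  by rewrite mulr_ge0// P0.
set a := Num.sqrt 3 ^+ d in ll.
have a0 : 0 < a by rewrite exprn_gt0// sqrt3_gt0.
(* The extra factor 1/d makes [l0] K equal to 2/d, so the loss 1 - [l0] K tends to 1, at the cost of
   only log d in the exponent [c]. *)
pose l0 := (a * d%:R)^-1.
have l00 : 0 < l0 by rewrite invr_gt0 mulr_gt0.
have l0l : l0 <= l%:num.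
  apply: le_trans ll; rewrite lef_pV2 ?posrE ?mulr_gt0// ler_peMr ?(ltW a0)//.
  by rewrite ler1n.
pose c := 1 + (d%:R * kappa R - 2 * ln d%:R).
have K : l0 * (2 * a) = 2 * u ^+ 2.
  by rewrite u2 /l0; field; rewrite !gt_eqF.
have [u21 ku] := density_slack k0 u0 g0.
have c_ge : d%:R * (kappa R - 4 * u) <= c by exact: exponent_ge.
have c0 : 0 <= c by apply: le_trans c_ge; rewrite mulr_ge0// ltW.
have lK : l0 * (2 * a) <= 1 by rewrite K.
have Eloc (v : Rd R d) A : measurable A -> A `<=` S `&` xsection (@overlap R d) v ->
    (\int[@vol R d]_(x in A) vol (A `&` xsection (@overlap R d) x)
      <= (2 * a)%:E * vol A)%E.
  by move=> mA AS; apply: (@overlap_local R d d0 v) => // x /AS[].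
have EV (x : Rd R d) : S x -> (vol (xsection (@overlap R d) x) <= (2 ^+ d)%:E)%E.
  by move=> _; rewrite xsection_overlap vol_ball.
have := occupancy mE (@overlap_sym R d) (ltW l00) mS Soo lK c0 Eloc EV.
rewrite -(fineK (Zfin _ (ltW l00))) -(fineK (Pfin _ (ltW l00))).
have Sfin : vol S \is a fin_num by rewrite ge0_fin_numE.
rewrite -[X in (_ * (X * _) <= _)%E](fineK Sfin).
rewrite -!EFinM lee_fin.
set M := fine (vol S); set z := fine (gas_partition _ _ _ _); set p := fine (peel _ _ _ _).
move=> occ.
pose m := g * d%:R / 2 ^+ d * M.
have m0 : 0 <= m by rewrite mulr_ge0 ?(ltW M0)// divr_ge0// mulr_ge0// ltW.
(* [m] is the target density times the volume of [S]; by [peel_Z_mono] a lower bound [m] on the mean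
   at [l0] carries over to [l]. *)
suff low : m * z <= l0 * p.
  have := peel_Z_mono mS bS l00 l0l m0.
  rewrite -(fineK (Zfin _ (ltW l00))) -(fineK (Pfin _ (ltW l00))).
  rewrite -(fineK (Zfin _ ln0)) -(fineK (Pfin _ ln0)) -!EFinM !lee_fin => /(_ low).
  have z0 : 0 < fine (gas_partition (@vol R d) (@overlap R d) l%:num S).
    exact: lt_le_trans ltr01 (Z1 _ ln0).
  by rewrite packing_densityE// !ler_pdivlMr// mulrAC.
have expc : expR (c - 1) = l0 * 2 ^+ d * u ^+ 2.
  rewrite /c [1 + _ - 1]addrC addKr expR_kappa// expr_div_n -/a u2 /l0.
  by field; rewrite !gt_eqF.
apply: (density_arith k0 u0 dR _ (ltW l00) (ltW M0) _ _ u21 c_ge).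
- by rewrite exprn_gt0.
- by apply: le_trans ler01 _; exact: Z1 (ltW l00).
- exact: P0 (ltW l00).
- by rewrite -K -expc.
Qed.

Theorem theorem2 (R : realType) :
  exists eps : nat -> R,
    (eps n @[n --> \oo] --> (0 : R)) /\
    forall (d : nat) (hd : (1 <= d)%N)
      (S : set (Rd R d)) (mS : measurable S),
      ebounded S ->
      (0 < vol S)%E ->
      forall l : {posnum R},
        3 `^ (- (d%:R / 2)) <= l%:num ->
        (1 + eps d) * (ln (2 / Num.sqrt 3) * d%:R / 2 ^+ d)
          <= packing_density mS l.
Proof.
exists (@density_error R); split; first exact: cvg_density_error.
move=> d d0 S mS bS S0 l; rewrite powR_sqrt3 => ll.
exact: packing_density_lower_bound.
Qed.
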